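(* Let $m\geq 0$ be an integer, $0<\alpha\leq 1$ and $f\in C^{m,\alpha}(\mathbb{R}^d)$. Suppose that $\sigma$ is a compactly supported (signed) Borel measure on $\mathbb{R}^d$ of finite total variation such that $$\int_{\mathbb{R}^d} x^k\, d\sigma(x)=0$$ for any multiindex $k$ with $0\leq |k|\leq [m+\alpha]$. For $0<\varepsilon<1$ and $x\in\mathbb{R}^d$ let $$\Theta^{\sigma}_{\varepsilon}f(x):=\int_{\varepsilon}^1 \frac{\Delta_\sigma f(x,h)}{h^{m+\alpha}}\,\frac{dh}{h},\qquad \Delta_{\sigma}f(x,h):=\int_{\mathbb{R}^d} f(x+hw)\,d\sigma(w).$$ Then the set $$\Big\{x\in\mathbb{R}^d:\ \sup_{0<\varepsilon<1}|\Theta^\sigma_\varepsilon f(x)|<\infty\Big\}$$ has Hausdorff dimension $d$.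
   Context: For $0<\alpha<1$, $\Lambda_\alpha(\mathbb{R}^d)$ is the space of functions $g:\mathbb{R}^d\to\mathbb{R}$ with $\sup \frac{|g(x+h)-g(x)|}{|h|^\alpha}<\infty$. For $\alpha=1$, $\Lambda_1(\mathbb{R}^d)$ is the Zygmund class: all continuous functions $g:\mathbb{R}^d\to\mathbb{R}$ with $\sup\frac{|g(x+h)+g(x-h)-2g(x)|}{|h|}<\infty$. Both suprema are over all $x\in\mathbb{R}^d$ and $h\in\mathbb{R}^d\setminus\{0\}$. A multiindex is $k=(k_1,\dots,k_d)$ with integers $k_i\ge 0$; $|k|=k_1+\cdots+k_d$ and $x^k=x_1^{k_1}\cdots x_d^{k_d}$. For an integer $m\ge 0$ and $0<\alpha\le 1$, $C^{m,\alpha}(\mathbb{R}^d)$ is the space of functions $f:\mathbb{R}^d\to\mathbb{R}$ that are $m$ times differentiable and all of whose derivatives of order $m$ belong to $\Lambda_\alpha(\mathbb{R}^d)$. $[\beta]$ denotes the integer part of $\beta$ (the largest integer less than or equal to $\beta$). *)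

(* Defs.v *)
From HB Require Import structures.
From mathcomp Require Import all_boot all_order all_algebra.
From mathcomp Require Import all_classical all_reals all_analysis.

Set Implicit Arguments.
Unset Strict Implicit.
Unset Printing Implicit Defensive.

Import Order.TTheory GRing.Theory Num.Theory.
Import numFieldNormedType.Exports.

Local Open Scope classical_set_scope.
Local Open Scope ring_scope.

Section EuclideanSpace.
Context {R : realType} {d : nat}.
Implicit Types (x h v : 'rV[R]_d) (E U : set 'rV[R]_d).

(* The library's norm on 'rV[R]_d is the sup norm; it induces the same topology
   and the same differentiability as this one. *)
Definition enorm v : R := Num.sqrt (\sum_(i < d) v ord0 i ^+ 2).

(* diam set0 = -oo *)
Definition diam U : \bar R :=
  ereal_sup [set (enorm (x - y))%:E | x in U & y in U].

(* diam(U)^s, where the empty set counts for 0 and a singleton has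
   diam^0 = 1, so that the 0-dimensional measure is the counting measure. *)
Definition diam_pow (s : R) U : \bar R :=
  if U == set0 then 0%E else (diam U `^ s)%E.

Definition hausdorff_content (delta s : R) E : \bar R :=
  ereal_inf [set (\sum_(0 <= i <oo) diam_pow s (U i))%E |
    U in [set U : (set 'rV[R]_d)^nat |
      E `<=` \bigcup_i U i /\ forall i, (diam (U i) <= delta%:E)%E]].

Definition hausdorff_measure (s : R) E : \bar R :=
  ereal_sup [set hausdorff_content delta s E | delta in [set delta : R | 0 < delta]].

Definition hausdorff_dim E : \bar R :=
  ereal_inf [set s%:E | s in [set s : R | 0 <= s /\ hausdorff_measure s E = 0%E]].

End EuclideanSpace.

Section SmoothnessClasses.
Context {R : realType} {d : nat}.
Implicit Types (f g : 'rV[R]_d -> R).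

Definition holder_class (alpha : R) g : Prop :=
  (ereal_sup [set (`|g (x + h) - g x| / enorm h `^ alpha)%:E |
     x in [set: 'rV[R]_d] & h in [set h : 'rV[R]_d | h != 0%R]] < +oo)%E.

Definition zygmund_class g : Prop :=
  continuous g /\
  (ereal_sup [set (`|g (x + h) + g (x - h) - 2 * g x| / enorm h)%:E |
     x in [set: 'rV[R]_d] & h in [set h : 'rV[R]_d | h != 0%R]] < +oo)%E.

Definition Lambda (alpha : R) g : Prop :=
  if alpha == 1 then zygmund_class g else holder_class alpha g.

Definition partial (i : 'I_d) f : 'rV[R]_d -> R :=
  fun x => 'D_(delta_mx ord0 i) f x.

Fixpoint times_differentiable (m : nat) f : Prop :=
  if m is n.+1 then
    (forall x, differentiable f x) /\
    forall i, times_differentiable n (partial i f)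
  else True.

(* The derivatives of order m are the iterated partial derivatives along all
   words of length m in the coordinate directions. *)
Definition C_class (m : nat) (alpha : R) f : Prop :=
  times_differentiable m f /\
  forall s : m.-tuple 'I_d, Lambda alpha (foldr partial f s).

End SmoothnessClasses.

Notation borelRd R d := (g_sigma_algebraType (@open 'rV[R]_d)).

Section SignedMeasures.
Context {R : realType} {disp : measure_display} {T : measurableType disp}.
Variable sigma : {charge set T -> \bar R}.

Definition hahn_pos_set : set T := projT1 (cid (Hahn_decomposition sigma)).

Definition hahn_neg_set : set T :=
  projT1 (cid (projT2 (cid (Hahn_decomposition sigma)))).

Definition hahn_pos_negP :
    hahn_decomposition sigma hahn_pos_set hahn_neg_set :=
  projT2 (cid (projT2 (cid (Hahn_decomposition sigma)))).

(* The choice of the Hahn decomposition is irrelevant: the Jordan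
   decomposition does not depend on it (Hahn_decomposition_uniq). *)
Definition charge_Rintegral (g : T -> R) : R :=
  \int[jordan_pos hahn_pos_negP]_x g x - \int[jordan_neg hahn_pos_negP]_x g x.

Definition total_variation : set T -> \bar R :=
  charge_variation hahn_pos_negP.

End SignedMeasures.

(* A charge takes finite values on all measurable sets, hence a charge on
   borelRd R d is exactly a signed Borel measure of finite total variation. *)
Section BorelCharges.
Context {R : realType} {d : nat}.
Variable sigma : {charge set (borelRd R d) -> \bar R}.

Definition charge_support : set 'rV[R]_d :=
  [set x | forall U : set 'rV[R]_d,
     open U -> U x -> (0 < total_variation sigma U)%E].

Definition compactly_supported : Prop := compact charge_support.

Definition monomial (k : 'I_d -> nat) (x : 'rV[R]_d) : R :=
  \prod_(i < d) x ord0 i ^+ k i.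

Definition Delta (f : 'rV[R]_d -> R) (x : 'rV[R]_d) (h : R) : R :=
  charge_Rintegral sigma (fun w : borelRd R d => f (x + h *: (w : 'rV[R]_d))).

(* beta stands for m + alpha. *)
Definition Theta (beta eps : R) (f : 'rV[R]_d -> R) (x : 'rV[R]_d) : R :=
  \int[lebesgue_measure]_(h in `[eps, 1]) (Delta f x h / h `^ beta / h).

End BorelCharges.

(* Main.v *)
Require Import Defs.
From HB Require Import structures.
From mathcomp Require Import all_boot all_order all_algebra.
From mathcomp Require Import all_classical all_reals all_analysis.
From mathcomp Require Import ring lra.

(** Write b = m + alpha and U eps x for the integral of D(x, h) h^(-b) dh/h over
    [eps, 1], where D(x, h) is the integral of f (x + h w) against sigma. Since
    D(x, h) is only known to be O(h^b), U eps x may grow like log (1/eps); the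
    theorem says that it stays bounded on a set of full dimension. The reason is
    that U behaves like a dyadic martingale with bounded increments, and such a
    martingale stays bounded on a set of full dimension.

    The martingale. Three estimates on the dilates D are needed: their size
    O(h^b); a gain (|y|/h)^q when x is shifted by y (Lemma estimates, second
    part); and a gain (h/l)^p when f is replaced by its mean over a cube of side
    l (third part), because averaging makes f smoother at scales below l while
    sigma annihilates polynomials of degree up to the integer part of b. All
    three are proved by induction on m, differentiating D in h or in x with the
    mean value theorem bf_mean_value, which trades f for its partial derivatives
    and sigma for its product with a coordinate. At m = 0 and alpha < 1 they are
    immediate; at alpha = 1 they rest on the bound C sqrt (|y| |z|) for mixed
    second differences of a Zygmund function (zygmund_mixed) and on an
    approximation by affine functions (affine_approximation). Integrated against
    dh/h, the two gains show that the mean of U u over a cube of side l, for any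
    u < l, is within a constant of U l on that cube
    (trunc_integral_approximate_martingale). The means are taken over finite
    grids, and a limit along an ultrafilter as the mesh vanishes gives an exact
    martingale M on dyadic cubes at a bounded distance from U (limit_martingale).

    The dimension. Let phi = max (0, L^2 - t^2). When M has increments at most A,
    the mean of phi (M) over the 2^d halves of a cube is at least
    (1 - A/L) phi (M) (potential_support). For L large, the weights
    phi (M) 2^(-n s) of cubes of generation n are then subadditive for an
    exponent s as close to d as desired. Given a cover that is too cheap, one
    descends from the unit cube, always into a half that outweighs the part of
    the cover below it (surviving_path); the limit point is not covered, while
    |M| < L along its path, so that U is bounded there. This bounds the Hausdorff
    content of exponent s from below (martingale_content). Conversely, no subset
    of the space has dimension more than d (hausdorff_dim_le). *)

Set Implicit Arguments.
Unset Strict Implicit.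
Unset Printing Implicit Defensive.

Import Order.TTheory GRing.Theory Num.Theory.
Import numFieldNormedType.Exports.

Local Open Scope classical_set_scope.
Local Open Scope ring_scope.

(** * Averages over dyadic cubes *)

Section CubeAverages.
Context {R : realType} {d : nat}.
Local Notation V := 'rV[R]_d.
Local Notation corner := {ffun 'I_d -> bool}.
Implicit Types (f g : V -> R) (x y a v : V) (u c : R) (e : corner).

Definition bits e : V := \row_i (e i)%:R.

Definition cmean (F : corner -> R) : R := (2 ^+ d)^-1 * \sum_e F e.

(** The mean of f over the points of mesh u in the cube of side 2^k u with
    corner a. By this recursion the mean over a cube is by definition the mean
    over its 2^d halves; and being a finite mean, it commutes with every linear
    functional, with no appeal to Fubini's theorem. *)
Fixpoint cubeavg u k f a : R :=
  if k is k'.+1 then cmean (fun e => cubeavg u k' f (a + (2 ^+ k' * u) *: bits e))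
  else f a.

Definition fdiff y f : V -> R := fun x => f (x + y) - f x.

Lemma card_corner : #|{: corner}| = (2 ^ d)%N.
Proof. by rewrite card_ffun card_bool card_ord. Qed.

Lemma eq_cmean F G : F =1 G -> cmean F = cmean G.
Proof. by move=> FG; rewrite /cmean (eq_bigr G). Qed.

Lemma cmeanD F G : cmean (fun e => F e + G e) = cmean F + cmean G.
Proof. by rewrite /cmean big_split mulrDr. Qed.

Lemma cmeanB F G : cmean (fun e => F e - G e) = cmean F - cmean G.
Proof. by rewrite /cmean sumrB mulrBr. Qed.

Lemma cmeanZ c F : cmean (fun e => c * F e) = c * cmean F.
Proof. by rewrite /cmean -mulr_sumr mulrCA. Qed.

Lemma cmean_const c : cmean (fun=> c) = c.
Proof.
rewrite /cmean sumr_const card_corner -[c *+ _]mulr_natl natrX mulKf ?expf_neq0 ?pnatr_eq0 //.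
Qed.

Lemma ler_cmean F G : (forall e, F e <= G e) -> cmean F <= cmean G.
Proof.
by move=> FG; rewrite ler_wpM2l ?invr_ge0 ?exprn_ge0 //; apply: ler_sum.
Qed.

Lemma ler_norm_cmean c F : (forall e, `|F e| <= c) -> `|cmean F| <= c.
Proof.
move=> Fc; rewrite ler_norml -{1}(cmean_const (- c)) -{2}(cmean_const c).
by apply/andP; split; apply: ler_cmean => e; move: (Fc e); rewrite ler_norml => /andP[].
Qed.

Lemma eq_cubeavg u k f g : f =1 g -> cubeavg u k f =1 cubeavg u k g.
Proof.
by move=> fg; elim: k => [|k IH] a //=; apply: eq_cmean => e.
Qed.

Lemma cubeavg_shift u k f v a :
  cubeavg u k (fun x => f (x + v)) a = cubeavg u k f (a + v).
Proof.
elim: k a => [|k IH] a //=; apply: eq_cmean => e.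
by rewrite IH addrAC.
Qed.

Lemma cubeavgD u k f g a :
  cubeavg u k (fun x => f x + g x) a = cubeavg u k f a + cubeavg u k g a.
Proof.
elim: k a => [|k IH] a //=; rewrite -cmeanD; apply: eq_cmean => e.
by rewrite IH.
Qed.

Lemma cubeavgZ u k c f a :
  cubeavg u k (fun x => c * f x) a = c * cubeavg u k f a.
Proof.
elim: k a => [|k IH] a //=; rewrite -cmeanZ; apply: eq_cmean => e.
by rewrite IH.
Qed.

Lemma cubeavgB u k f g a :
  cubeavg u k (fun x => f x - g x) a = cubeavg u k f a - cubeavg u k g a.
Proof.
elim: k a => [|k IH] a //=; rewrite -cmeanB; apply: eq_cmean => e.
by rewrite IH.
Qed.

Lemma cubeavg_const u k c a : cubeavg u k (fun=> c) a = c.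
Proof.
by elim: k a => [|k IH] a //=; rewrite -[RHS]cmean_const; apply: eq_cmean.
Qed.

Lemma cubeavg_fdiff u k y f a : cubeavg u k (fdiff y f) a = fdiff y (cubeavg u k f) a.
Proof. by rewrite /fdiff cubeavgB cubeavg_shift. Qed.

Lemma cubeavg_sum u k (J : Type) (r : seq J) (G : J -> V -> R) a :
  cubeavg u k (fun x => \sum_(j <- r) G j x) a = \sum_(j <- r) cubeavg u k (G j) a.
Proof.
elim: r => [|j r IH].
  rewrite big_nil (eq_cubeavg _ _ (g := fun=> 0)) ?cubeavg_const // => x.
  by rewrite big_nil.
rewrite big_cons -IH -cubeavgD; apply: eq_cubeavg => x.
by rewrite big_cons.
Qed.

Lemma cubeavg_cmean u k (G : corner -> V -> R) a :
  cubeavg u k (fun x => cmean (G ^~ x)) a = cmean (fun e => cubeavg u k (G e) a).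
Proof. by rewrite /cmean cubeavgZ cubeavg_sum. Qed.

Lemma norm_rV_le c x : 0 <= c -> (forall i, `|x ord0 i| <= c) -> `|x| <= c.
Proof.
move=> c0 xc; rewrite -[`|x|]/(mx_norm x) mx_normrE; apply: bigmax_le => // -[i j] _ /=.
by rewrite (ord1 i).
Qed.

Lemma ler_coord_norm x i : `|x ord0 i| <= `|x|.
Proof.
rewrite -[`|x|]/(mx_norm x) mx_normrE.
exact: (le_bigmax 0 (fun p : 'I_1 * 'I_d => `|x p.1 p.2|) (ord0, i)).
Qed.

Lemma norm_bits e : `|bits e| <= 1.
Proof.
by apply: norm_rV_le => // i; rewrite mxE; case: (e i); rewrite ?normr1 ?normr0.
Qed.

Lemma cubeavg_bound u k f a c : 0 <= u ->
  (forall y, `|y| <= 2 ^+ k * u -> `|f (a + y)| <= c) -> `|cubeavg u k f a| <= c.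
Proof.
move=> u0; elim: k a => [|k IH] a fc /=.
  by rewrite -[a in f a]addr0; apply: fc; rewrite normr0 mulr_ge0.
apply: ler_norm_cmean => e; apply: IH => y yk; rewrite -addrA; apply: fc.
apply: (le_trans (ler_normD _ _)); rewrite exprS -mulrA mulr_natl mulr2n lerD //.
rewrite normrZ ger0_norm ?mulr_ge0 ?exprn_ge0 //.
by rewrite ler_piMr ?norm_bits ?mulr_ge0 ?exprn_ge0.
Qed.

Lemma cubeavg_bound_all u k f c : (forall x, `|f x| <= c) ->
  forall a, `|cubeavg u k f a| <= c.
Proof.
move=> fc; elim: k => [|k IH] a //=; exact: ler_norm_cmean.
Qed.

Definition unitv (i : 'I_d) : V := delta_mx ord0 i.

Definition toggle (i : 'I_d) e : corner := [ffun j => if j == i then ~~ e j else e j].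

Lemma toggleK i : involutive (toggle i).
Proof. by move=> e; apply/ffunP => j; rewrite !ffunE; case: eqP => // _; rewrite negbK. Qed.

(** The 2^d differences of step t telescope in pairs, over corners that differ in
    the coordinate i, into 2^(d-1) differences of step 2t: the bound on those is
    halved. *)
Lemma cmean_edge_bound i f a t c :
  (forall x, `|f (x + (2 * t) *: unitv i) - f x| <= c) ->
  `|cmean (fun e => f (a + t *: bits e + t *: unitv i) - f (a + t *: bits e))|
  <= c / 2.
Proof.
move=> fc; set F := fun e => _.
have -> : cmean F = 2^-1 * cmean (fun e => F e + F (toggle i e)).
  rewrite cmeanD; suff -> : cmean (fun e => F (toggle i e)) = cmean F by lra.
  by rewrite /cmean; congr (_ * _); rewrite [RHS](reindex_inj (inv_inj (toggleK i))).
rewrite normrM ger0_norm ?invr_ge0 // mulrC ler_pM2r ?invr_gt0 //.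
apply: ler_norm_cmean => e.
wlog ei : e / e i = false => [H|].
  case ei: (e i); last exact: H.
  by rewrite addrC -{2}(toggleK i e); apply: H; rewrite ffunE eqxx ei.
have bt : bits (toggle i e) = bits e + unitv i.
  apply/rowP => j; rewrite !mxE ffunE eqxx /= (eq_sym j i).
  by case: (eqVneq i j) => [<-|_] /=; rewrite ?ei ?add0r ?addr0.
rewrite /F bt; set y := a + t *: bits e.
have -> : a + t *: (bits e + unitv i) = y + t *: unitv i by rewrite scalerDr addrA.
have -> : y + t *: unitv i + t *: unitv i = y + (2 * t) *: unitv i.
  by rewrite -addrA -scalerDl mulrDl mul1r.
by rewrite addrC addrA subrK; exact: fc.
Qed.

(** Differences at the mesh gain the factor u / (2^k u), as the derivative of a
    moving average is the difference quotient of the function at the width of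
    the window. *)
Lemma cubeavg_step i u k f c :
  (forall x, `|fdiff ((2 ^+ k * u) *: unitv i) f x| <= c) ->
  forall x, `|fdiff (u *: unitv i) (cubeavg u k f) x| <= c / 2 ^+ k.
Proof.
elim: k f c => [|k IH] f c fc x /=.
  by move: (fc x); rewrite expr0 mul1r divr1.
pose g x := cmean (fun e => f (x + (2 ^+ k * u) *: bits e)).
have Eg y : cubeavg u k.+1 f y = cubeavg u k g y.
  rewrite /= /g cubeavg_cmean; apply: eq_cmean => e.
  by rewrite cubeavg_shift.
rewrite /fdiff -!/(cubeavg u k.+1 f _) !Eg exprS invfM mulrA.
apply: IH => {}x; rewrite /fdiff /g -cmeanB.
under eq_cmean do rewrite addrAC.
by apply: cmean_edge_bound => y; rewrite mulrA -exprS; apply: fc.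
Qed.

Lemma fdiff_nat q y f c : (forall x, `|fdiff y f x| <= c) ->
  forall x, `|fdiff (q%:R *: y) f x| <= q%:R * c.
Proof.
move=> fc; elim: q => [|q IH] x.
  by rewrite /fdiff scale0r addr0 subrr normr0 mul0r.
have -> : fdiff (q.+1%:R *: y) f x = fdiff (q%:R *: y) f (x + y) + fdiff y f x.
  by rewrite /fdiff -nat1r scalerDl scale1r [in RHS]addrA subrK addrA.
apply: (le_trans (ler_normD _ _)); rewrite -natr1 mulrDl mul1r lerD //.
Qed.

Lemma fdiffN y f x : fdiff (- y) f x = - fdiff y f (x - y).
Proof. by rewrite /fdiff subrK opprB. Qed.

(** A step s is a whole number of mesh steps, where the average moves at the rate
    of the differences of f at the cube scale, plus a remainder shorter than the
    mesh, for which averaging brings nothing. *)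
Lemma cubeavg_modulus i u k f c1 c2 s : 0 < u -> 0 <= c1 ->
  (forall x, `|fdiff ((2 ^+ k * u) *: unitv i) f x| <= c1) ->
  (forall r, 0 <= r <= u -> forall x, `|fdiff (r *: unitv i) f x| <= c2) ->
  forall x, `|fdiff (s *: unitv i) (cubeavg u k f) x| <= `|s| / (2 ^+ k * u) * c1 + c2.
Proof.
move=> u0 c10 fc1 fc2.
wlog s0 : s / 0 <= s => [H x|].
  have [s0|/ltW s0] := leP 0 s; first exact: H.
  have := H (- s); rewrite oppr_ge0 normrN => /(_ s0 (x + s *: unitv i)).
  by rewrite scaleNr fdiffN normrN addrK.
rewrite (ger0_norm s0) => x.
pose q := Num.trunc (s / u).
have su0 : 0 <= s / u by rewrite divr_ge0 // ltW.
have /andP[q1 q2] := truncn_itv su0; rewrite -/q in q1 q2.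
have qs : q%:R * u <= s by rewrite -ler_pdivlMr.
pose r := s - q%:R * u.
have r0 : 0 <= r by rewrite subr_ge0.
have ru : r <= u.
  by rewrite lerBlDr -[X in X + _]mul1r -mulrDl nat1r -ler_pdivrMr // ltW.
have -> : fdiff (s *: unitv i) (cubeavg u k f) x =
   fdiff (q%:R *: (u *: unitv i)) (cubeavg u k f) (x + r *: unitv i) +
   fdiff (r *: unitv i) (cubeavg u k f) x.
  by rewrite /fdiff scalerA [in RHS]addrA subrK -addrA -scalerDl /r subrK.
apply: (le_trans (ler_normD _ _)); apply: lerD.
  apply: (le_trans (fdiff_nat q (cubeavg_step fc1) _)).
  have -> : s / (2 ^+ k * u) * c1 = s / u * (c1 / 2 ^+ k).
    by field; rewrite ?gt_eqF ?exprn_gt0 ?ltr0n.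
  by rewrite ler_wpM2r // divr_ge0.
rewrite -cubeavg_fdiff; apply: cubeavg_bound_all => y.
by apply: fc2; rewrite r0 ru.
Qed.

Definition trunc_row (k : nat) v : V := \row_j (if (j < k)%N then v ord0 j else 0).

Lemma norm_trunc_row k v : `|trunc_row k v| <= `|v|.
Proof.
apply: norm_rV_le => // j; rewrite mxE; case: ifP => _; last by rewrite normr0.
exact: ler_coord_norm.
Qed.

Lemma trunc_rowS (i : 'I_d) v : trunc_row i.+1 v = trunc_row i v + v ord0 i *: unitv i.
Proof.
apply/rowP => j; rewrite !mxE eqxx /= ltnS leq_eqVlt.
have [ji|ji] := eqVneq j i; first by rewrite ji eqxx ltnn mulr1 add0r.
by rewrite (negbTE (_ : (j : nat) != i)) //= mulr0 addr0.
Qed.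

Lemma fdiff_coord v f x :
  fdiff v f x = \sum_(i < d) fdiff (v ord0 i *: unitv i) f (x + trunc_row i v).
Proof.
have T0 : trunc_row 0 v = 0 by apply/rowP => j; rewrite !mxE.
have Td : trunc_row d v = v by apply/rowP => j; rewrite !mxE ltn_ord.
rewrite /fdiff -{1}Td -{2}[x]addr0 -T0 -(telescope_sumr (fun k => f (x + trunc_row k v))) //.
rewrite big_mkord; apply: eq_bigr => i _.
by rewrite trunc_rowS addrA.
Qed.

Lemma norm_unitv i t : `|t *: unitv i| <= `|t|.
Proof.
apply: norm_rV_le => // j; rewrite !mxE eqxx /=.
by case: eqP => _; rewrite ?mulr1 ?mulr0 ?normr0.
Qed.

End CubeAverages.

(** * Compactly supported functionals and their dilates *)

Section Functionals.
Context {R : realType} {d : nat}.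
Local Notation V := 'rV[R]_d.
Implicit Types (f g : V -> R) (x y z v w : V) (I : (V -> R) -> R).

(** What is used of an integral against a charge carried by the ball of radius
    rho. Unlike charges themselves, such functionals are visibly stable under
    multiplication of the integrand by a coordinate, on which the induction on
    the order of smoothness relies. *)
Record bounded_functional I (rho B : R) : Prop := BoundedFunctional {
  bf_rho : 0 < rho;
  bf_B : 0 <= B;
  bfD : forall f g, continuous f -> continuous g ->
    I (fun w => f w + g w) = I f + I g;
  bfZ : forall c f, continuous f -> I (fun w => c * f w) = c * I f;
  bf_bound : forall f c, continuous f ->
    (forall w, `|w| <= rho -> `|f w| <= c) -> `|I f| <= B * c }.

Definition kills (p : nat) I : Prop :=
  forall k : 'I_d -> nat, (\sum_(i < d) k i <= p)%N -> I (monomial k) = 0.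

Definition dil I f x h : R := I (fun w => f (x + h *: w)).

Lemma killsW p q I : (q <= p)%N -> kills p I -> kills q I.
Proof. by move=> qp kp k kq; apply: kp; apply: leq_trans qp. Qed.

Lemma continuous_coord i : continuous (fun w : V => w ord0 i).
Proof. exact: coord_continuous. Qed.

Lemma continuous_dilate x h : continuous (fun w : V => x + h *: w).
Proof.
move=> w; apply: (@continuousD _ _ _ (fun=> x) (fun w => h *: w)).
  exact: cst_continuous.
by apply: continuousZl_tmp; exact: cvg_id.
Qed.

Lemma continuous_dil_arg f x h : continuous f -> continuous (fun w : V => f (x + h *: w)).
Proof.
move=> cf w; apply: (@continuous_comp _ _ _ (fun w => x + h *: w) f); last exact: cf.
exact: continuous_dilate.
Qed.

Lemma continuous_shift f y : continuous f -> continuous (fun x : V => f (x + y)).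
Proof.
move=> cf x; apply: (@continuous_comp _ _ _ (fun x => x + y) f); last exact: cf.
by apply: (@continuousD _ _ _ id (fun=> y)); [exact: cvg_id|exact: cst_continuous].
Qed.

Lemma continuousDf f g : continuous f -> continuous g -> continuous (fun x => f x + g x).
Proof. by move=> cf cg x; apply: (@continuousD _ _ _ f g); [exact: cf|exact: cg]. Qed.

Lemma continuousBf f g : continuous f -> continuous g -> continuous (fun x => f x - g x).
Proof. by move=> cf cg x; apply: (@continuousB _ _ _ f g); [exact: cf|exact: cg]. Qed.

Lemma continuousMf f g : continuous f -> continuous g -> continuous (fun x => f x * g x).
Proof. by move=> cf cg x; apply: (@continuousM _ _ f g); [exact: cf|exact: cg]. Qed.

Lemma continuous_cstf (c : R) : continuous (fun _ : V => c).
Proof. exact: cst_continuous. Qed.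

Lemma continuous_fdiff y f : continuous f -> continuous (fdiff y f).
Proof. by move=> cf; apply: continuousBf => //; exact: continuous_shift. Qed.

Lemma continuous_sumf (J : Type) (r : seq J) (F : J -> V -> R) :
  (forall j, continuous (F j)) -> continuous (fun x => \sum_(j <- r) F j x).
Proof.
move=> cF; elim: r => [|j r IH].
  by under eq_fun do rewrite big_nil; exact: continuous_cstf.
by under eq_fun do rewrite big_cons; exact: continuousDf.
Qed.

Lemma continuous_cmean (F : {ffun 'I_d -> bool} -> V -> R) :
  (forall e, continuous (F e)) -> continuous (fun x => cmean (F ^~ x)).
Proof.
move=> cF; apply: continuousMf; first exact: continuous_cstf.
exact: continuous_sumf.
Qed.

Lemma continuous_cubeavg u k f : continuous f -> continuous (cubeavg u k f).
Proof.
move=> cf; elim: k => [//|k IH] /=; apply: continuous_cmean => e.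
exact: continuous_shift.
Qed.

Section Bounded.
Variables (I : (V -> R) -> R) (rho B : R).
Hypothesis bI : bounded_functional I rho B.

Lemma bfB f g : continuous f -> continuous g ->
  I (fun w => f w - g w) = I f - I g.
Proof.
move=> cf cg.
have -> : (fun w => f w - g w) = (fun w => f w + (-1) * g w).
  by apply/funext => w; rewrite mulN1r.
rewrite (bfD bI) ?(bfZ bI) ?mulN1r //.
by apply: continuousMf => //; exact: continuous_cstf.
Qed.

Lemma bf0 : I (fun=> 0) = 0.
Proof.
rewrite -[RHS](mul0r (I (fun=> 0))) -(bfZ bI); last exact: continuous_cstf.
by congr (I _); apply/funext => w; rewrite mul0r.
Qed.

Lemma bf_sum (J : Type) (r : seq J) (F : J -> V -> R) :
  (forall j, continuous (F j)) ->
  I (fun w => \sum_(j <- r) F j w) = \sum_(j <- r) I (F j).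
Proof.
move=> cF; elim: r => [|j r IH].
  rewrite big_nil -[RHS]bf0; congr (I _).
  by apply/funext => w; rewrite big_nil.
rewrite big_cons -IH -(bfD bI) //; last exact: continuous_sumf.
by congr (I _); apply/funext => w; rewrite big_cons.
Qed.

Lemma monomial0 : monomial (fun=> 0%N) = (fun=> 1) :> (V -> R).
Proof. by apply/funext => w; rewrite /monomial big1. Qed.

Lemma bf_kill_cst p c : kills p I -> I (fun=> c) = 0.
Proof.
move=> kI; have <- : c * I (monomial (fun=> 0%N)) = 0.
  by rewrite kI ?mulr0 // big1.
rewrite monomial0 -(bfZ bI); last exact: continuous_cstf.
by congr (I _); apply/funext => w; rewrite mulr1.
Qed.

Lemma monomial1 i w : monomial (fun j => (j == i) : nat) w = w ord0 i :> R.
Proof.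
rewrite /monomial (bigD1 i) //= eqxx expr1 big1 ?mulr1 // => j /negbTE ->.
by rewrite expr0.
Qed.

Lemma bf_kill_lin p c i : kills p.+1 I -> I (fun w => c * w ord0 i) = 0.
Proof.
move=> kI; rewrite (bfZ bI); last exact: continuous_coord.
have -> : (fun w : V => w ord0 i) = monomial (fun j => (j == i) : nat).
  by apply/funext => w; rewrite monomial1.
rewrite kI ?mulr0 // (bigD1 i) //= eqxx big1 // => j /negbTE ->.
by [].
Qed.

Lemma dil_bound f x h c : continuous f ->
  (forall w, `|w| <= rho -> `|f (x + h *: w)| <= c) -> `|dil I f x h| <= B * c.
Proof. by move=> cf; apply: (bf_bound bI); exact: continuous_dil_arg. Qed.

(** A functional that kills constants sees only the oscillation of f. *)
Lemma dil_osc_bound p f x h c : continuous f -> kills p I ->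
  (forall w, `|w| <= rho -> `|fdiff (h *: w) f x| <= c) -> `|dil I f x h| <= B * c.
Proof.
move=> cf kI fc; have <- : dil I (fun y => f y - f x) x h = dil I f x h.
  rewrite /dil bfB ?(bf_kill_cst _ kI) ?subr0 //; first exact: continuous_dil_arg.
  exact: continuous_cstf.
by apply: dil_bound => //; apply: continuousBf => //; exact: continuous_cstf.
Qed.

(** A functional that kills affine functions sees only the distance from f to them. *)
Lemma dil_affine_bound p f x h c (L : 'I_d -> R) : continuous f -> kills p.+1 I ->
  (forall v, `|v| <= `|h| * rho -> `|fdiff v f x - \sum_i v ord0 i * L i| <= c) ->
  `|dil I f x h| <= B * c.
Proof.
move=> cf kI fc.
have cl i : continuous (fun w : V => h * L i * w ord0 i).
  by apply: continuousMf; [exact: continuous_cstf|exact: continuous_coord].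
have cfx : continuous (fun w : V => f (x + h *: w) - f x).
  by apply: continuousBf; [exact: continuous_dil_arg|exact: continuous_cstf].
have <- : I (fun w => (f (x + h *: w) - f x) - \sum_i (h * L i * w ord0 i)) = dil I f x h.
  rewrite bfB //; last exact: continuous_sumf.
  rewrite bf_sum // big1 ?subr0; last by move=> i _; rewrite (bf_kill_lin _ _ kI).
  rewrite bfB ?(bf_kill_cst _ kI) ?subr0 //; first exact: continuous_dil_arg.
  exact: continuous_cstf.
apply: (bf_bound bI).
  by apply: continuousBf => //; exact: continuous_sumf.
move=> w wr; have := fc (h *: w); rewrite normrZ ler_wpM2l // => /(_ isT).
rewrite /fdiff; congr (`|_ - _| <= _).
by apply: eq_bigr => i _; rewrite mxE mulrAC.
Qed.

Lemma dil_fdiff f x y h : continuous f ->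
  dil I (fdiff y f) x h = dil I f (x + y) h - dil I f x h.
Proof.
move=> cf; rewrite /dil -bfB; [|exact: continuous_dil_arg..].
by congr (I _); apply/funext => w; rewrite /fdiff addrAC.
Qed.

Lemma dil_cubeavg f u k x h : continuous f ->
  dil I (cubeavg u k f) x h = cubeavg u k (fun y => dil I f y h) x.
Proof.
move=> cf; elim: k x => [//|k IH] x /=.
rewrite /dil /cmean (bfZ bI); last first.
  apply: (@continuous_sumf _ _ (fun e w => cubeavg u k f _)) => e.
  rewrite (_ : (fun w => _) = (fun w => cubeavg u k f ((x + (2 ^+ k * u) *: bits e) + h *: w))).
    by apply: continuous_dil_arg; exact: continuous_cubeavg.
  by apply/funext => w; rewrite addrAC.
rewrite bf_sum => [|e]; last first.
  rewrite (_ : (fun w => _) = (fun w => cubeavg u k f ((x + (2 ^+ k * u) *: bits e) + h *: w))).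
    by apply: continuous_dil_arg; exact: continuous_cubeavg.
  by apply/funext => w; rewrite addrAC.
congr (_ * _); apply: eq_bigr => e _; rewrite -IH /dil.
by congr (I _); apply/funext => w; rewrite addrAC.
Qed.

End Bounded.
End Functionals.

(** * Zygmund functions: mixed differences and local affine approximation *)

Section ZygmundGeometry.
Context {R : realType} {d : nat}.
Local Notation V := 'rV[R]_d.
Implicit Types (f g : V -> R) (x y z v : V) (r w : R).

Lemma fdiffC y z f x : fdiff y (fdiff z f) x = fdiff z (fdiff y f) x.
Proof.
rewrite /fdiff [x + y + z]addrAC; lra.
Qed.

Lemma zygmund_double f C y x :
  (forall x v, `|f (x + v) + f (x - v) - 2 * f x| <= C * `|v|) ->
  `|fdiff y f x - 2^-1 * fdiff (2 *: y) f x| <= C / 2 * `|y|.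
Proof.
move=> Zf; have := Zf (x + y) y; rewrite addrK -[x + y + y]addrA.
have -> : y + y = 2 *: y by rewrite scaler_nat mulr2n.
rewrite /fdiff; set a := f _; set b := f x; set c := f (x + y) => H.
have -> : c - b - 2^-1 * (a - b) = - (2^-1 * (a + b - 2 * c)) by lra.
by rewrite normrN normrM ger0_norm // mulrAC [C * _ / 2]mulrC ler_wpM2l.
Qed.

(** The mixed difference compares the two diagonals of a parallelogram, and both
    pairs of opposite vertices have the same midpoint. *)
Lemma zygmund_mixed_linear f C y z x : 0 <= C ->
  (forall x v, `|f (x + v) + f (x - v) - 2 * f x| <= C * `|v|) ->
  `|fdiff y (fdiff z f) x| <= C * (`|y| + `|z|).
Proof.
move=> C0 Zf.
pose c := x + 2^-1 *: (y + z); pose p := 2^-1 *: (y + z); pose q := 2^-1 *: (y - z).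
have half v : 2^-1 *: v + 2^-1 *: v = v.
  have -> : 2^-1 *: v + 2^-1 *: v = (2^-1 + 2^-1) *: v by rewrite scalerDl.
  rewrite (_ : 2^-1 + 2^-1 = 1) ?scale1r //; lra.

have pp : p + p = y + z := half _.
have pq : p + q = y by rewrite /p /q -scalerDr addrACA subrr addr0 scalerDr half.
have pq' : p - q = z.
  by rewrite /p /q -scalerBr opprB [y + z]addrC addrACA subrr addr0 scalerDr half.
have := Zf c p; have := Zf c q.
rewrite /c -/p -[x + p + q]addrA -[x + p - q]addrA -[x + p + p]addrA addrK.
rewrite pq pq' pp /fdiff -[x + y + z]addrA => H1 H2.
have -> : f (x + (y + z)) - f (x + y) - (f (x + z) - f x) =
   (f (x + (y + z)) + f x - 2 * f (x + p)) - (f (x + y) + f (x + z) - 2 * f (x + p)).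
  by lra.
apply: (le_trans (ler_normB _ _)); apply: (le_trans (lerD H2 H1)).
rewrite -mulrDr ler_wpM2l // !normrZ ger0_norm // -mulrDr.
have := ler_normD y z; have := ler_normB y z; lra.
Qed.

(** A first difference is half the difference of the doubled step, up to the
    step itself. Doubling the shorter step until both are comparable therefore
    costs a factor logarithmic in their ratio, which the geometric mean of the
    steps absorbs; it also makes the bound symmetric and reproducible by
    induction on the number of doublings. *)
Lemma zygmund_mixed f C : 0 <= C ->
  (forall x v, `|f (x + v) + f (x - v) - 2 * f x| <= C * `|v|) ->
  forall y z x, `|fdiff y (fdiff z f) x| <= 4 * C * Num.sqrt (`|y| * `|z|).
Proof.
move=> C0 Zf.
have main n : forall y z, `|z| <= 2 ^+ n * `|y| -> `|y| <= `|z| ->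
    forall x, `|fdiff y (fdiff z f) x| <= 4 * C * Num.sqrt (`|y| * `|z|).
  have sq y z : Num.sqrt (`|y| * `|z|) ^+ 2 = `|y| * `|z|.
    by rewrite sqr_sqrtr // mulr_ge0.
  (* |z| <= 2 sqrt (|y| |z|) as soon as |z| <= 2 |y| *)
  have comparable y z : `|z| <= 2 * `|y| -> `|y| <= `|z| ->
    forall x, `|fdiff y (fdiff z f) x| <= 4 * C * Num.sqrt (`|y| * `|z|).
    move=> zy yz x; apply: (le_trans (zygmund_mixed_linear _ _ _ C0 Zf)).
    rewrite [4 * C]mulrC -mulrA ler_wpM2l //.
    have := sq y z; set q := Num.sqrt _ => qE; have q0 : 0 <= q by exact: sqrtr_ge0.
    have := normr_ge0 y; have := normr_ge0 z => z0 y0.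
    suff : `|z| <= 2 * q by lra.
    rewrite -(@ler_pXn2r _ 2) ?nnegrE ?mulr_ge0 // exprMn qE; nra.
  elim: n => [|n IH] y z zy yz x.
    by apply: comparable => //; move: zy; rewrite expr0 mul1r => zy; have := normr_ge0 y; lra.
  have [zy2|/ltW yz2] := leP (`|z|) (2 * `|y|); first exact: comparable.
  have n2 : `|2 *: y| = 2 * `|y| by rewrite normrZ ger0_norm.
  have := IH (2 *: y) z; rewrite n2 mulrA -exprSr => /(_ zy yz2 x).
  set Q := Num.sqrt _ => H2.
  have := sq y z; set q := Num.sqrt _ => qE; have q0 : 0 <= q by exact: sqrtr_ge0.
  have Qq : Q <= 3 / 2 * q.
    rewrite -(@ler_pXn2r _ 2) ?nnegrE ?mulr_ge0 ?sqrtr_ge0 //.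
    rewrite /Q sqr_sqrtr ?mulr_ge0 // exprMn qE.
    have := mulr_ge0 (normr_ge0 y) (normr_ge0 z); lra.
  have yq : `|y| <= q.
    by rewrite -(@ler_pXn2r _ 2) ?nnegrE // qE expr2 ler_wpM2l.
  have dbl := zygmund_double y (x + z) Zf.
  have dbl0 := zygmund_double y x Zf.
  rewrite fdiffC /fdiff -/(fdiff y f (x + z)) -/(fdiff y f x).
  move: H2; rewrite fdiffC {1}/fdiff => H2.
  set a := fdiff y f (x + z) in dbl *; set b := fdiff y f x in dbl0 *.
  set a2 := fdiff _ f (x + z) in dbl H2; set b2 := fdiff _ f x in dbl0 H2.
  have -> : a - b = (a - 2^-1 * a2) - (b - 2^-1 * b2) + 2^-1 * (a2 - b2) by lra.
  apply: (le_trans (ler_normD _ _)).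
  apply: (le_trans (lerD (ler_normB _ _) (lexx _))).
  rewrite normrM (@ger0_norm _ 2^-1) //.
  have : C * `|y| <= C * q by rewrite ler_wpM2l.
  have : C * Q <= C * (3 / 2 * q) by rewrite ler_wpM2l.
  lra.
move=> y z x.
wlog yz : y z / `|y| <= `|z| => [H|].
  by have [|/ltW] := leP (`|y|) (`|z|); [exact: H|move/H; rewrite fdiffC mulrC [`|z| * _]mulrC mulrC].
have [y0|y0] := eqVneq y 0.
  rewrite y0 {1}/fdiff addr0 subrr normr0 !mulr_ge0 ?sqrtr_ge0 //.
have ny : 0 < `|y| by rewrite normr_gt0.
pose n := (Num.trunc (`|z| / `|y|)).+1.
apply: (main n) => //; rewrite -ler_pdivrMr //.
have /andP[_ /ltW h] := truncn_itv (divr_ge0 (normr_ge0 z) (normr_ge0 y)).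
apply: (le_trans h); rewrite -natrX ler_nat; exact: ltnW (ltn_expl _ _).
Qed.

(** Hyers' stability argument. At a maximum c of the absolute value, either c
    can be doubled, or its complement r - c can; as doubling the argument nearly
    doubles the value, the maximum is at most half of itself plus a multiple of w. *)
Lemma approx_additive_small (b : R -> R) (r w : R) : 0 <= r -> 0 <= w ->
  continuous b -> b r = 0 ->
  (forall s t, 0 <= s -> 0 <= t -> s + t <= r -> `|b (s + t) - b s - b t| <= w) ->
  forall s, 0 <= s <= r -> `|b s| <= 3 * w.
Proof.
move=> r0 w0 cb br ab s sr.
have cnb : {within `[0, r], continuous (fun t => `|b t|)}.
  apply: continuous_subspaceT => t.
  by apply: (@continuous_comp _ _ _ b Num.norm); [exact: cb|exact: norm_continuous].
have [c /[!in_itv]/= /andP[c0 cr] cmax] := EVT_max r0 cnb.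
suff bc : `|b c| <= 3 * w.
  by apply: le_trans bc; apply: cmax; rewrite in_itv.
have low t : 0 <= t -> t + t <= r -> `|b t| <= (`|b c| + w) / 2.
  move=> t0 tr; have := ab t t t0 t0 tr.
  have : `|b (t + t)| <= `|b c| by apply: cmax; rewrite in_itv /= tr addr_ge0.
  rewrite !ler_norml => /andP[? ?] /andP[? ?]; apply/andP; split; lra.
have [c2|c2] := leP (c + c) r; first by have := low c c0 c2; lra.
have rc0 : 0 <= r - c by rewrite subr_ge0.
have := low (r - c) rc0; have -> : r - c + (r - c) <= r by lra.
move=> /(_ isT) lo; have := ab c (r - c) c0 rc0; rewrite addrC subrK br lexx => /(_ isT).
rewrite sub0r => h; have : `|b c| <= w + `|b (r - c)|.
  have -> : b c = - (- b c - b (r - c)) - b (r - c) by lra.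
  by apply: (le_trans (ler_normB _ _)); rewrite normrN lerD2r.
lra.
Qed.

(** On each line through x in a coordinate direction, the increments of g from x
    are approximately additive, because their defect is a mixed difference, and
    hence approximately linear; mixed differences also allow the increments
    along successive coordinates to be taken all from x. *)
Lemma affine_approximation g r w : continuous g -> 0 < r -> 0 <= w ->
  (forall y z x, `|y| <= r -> `|z| <= r -> `|fdiff y (fdiff z g) x| <= w) ->
  forall x, exists L : 'I_d -> R, forall v, `|v| <= r ->
    `|fdiff v g x - \sum_i v ord0 i * L i| <= d%:R * (5 * w).
Proof.
move=> cg r0 w0 gw x.
pose L i := fdiff (r *: unitv i) g x / r.
have line (i : 'I_d) (s : R) : `|s| <= r -> `|fdiff (s *: unitv i) g x - s * L i| <= 4 * w.
  move=> sr.
  pose b (t : R) := fdiff (t *: unitv i) g x - t * L i.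
  have cb : continuous b.
    have cl : continuous (fun t : R => x + t *: unitv i).
      move=> t; apply: (@continuousD _ _ _ (fun=> x) (fun t : R => t *: unitv i)).
        exact: cst_continuous.
      by apply: cvgZr_tmp; exact: cvg_id.
    rewrite /b /fdiff => t; apply: (@continuousB _ _ _ (fun t : R => g (x + t *: unitv i) - g x) (fun t : R => t * L i)).
      apply: (@continuousB _ _ _ (fun t : R => g (x + t *: unitv i)) (fun=> g x)).
        by apply: (@continuous_comp _ _ _ (fun t : R => x + t *: unitv i) g); [exact: cl|exact: cg].
      exact: cst_continuous.
    by apply: (@continuousM _ _ id (fun=> L i)); [exact: cvg_id|exact: cst_continuous].
  have br : b r = 0 by rewrite /b /L mulrC divfK ?subrr // gt_eqF.
  have nu t : `|t| <= r -> `|t *: unitv (R := R) i| <= r by apply: le_trans; exact: norm_unitv.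
  have ab s' t : `|s'| <= r -> `|t| <= r -> `|b (s' + t) - b s' - b t| <= w.
    move=> s'r tr; have := gw _ _ x (nu _ s'r) (nu _ tr).
    rewrite /b /fdiff scalerDl -[x + _ + t *: _]addrA.
    set A := g _; set B := g _; set B' := g _; set D := g _; set l := L i.
    by congr (`|_| <= _); lra.
  have pos t : 0 <= t <= r -> `|b t| <= 3 * w.
    apply: approx_additive_small => //; first exact: ltW.
    by move=> s' t' s0 t0 st; apply: ab; rewrite ger0_norm //; lra.
  have [s0|/ltW s0] := leP 0 s.
    apply: (@le_trans _ _ (3 * w)); last by rewrite ler_wpM2r // ler_nat.
    by apply: pos; rewrite s0 -(ger0_norm s0).
  have := pos (- s); rewrite oppr_ge0 s0 -(ler0_norm s0) sr => /(_ isT).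
  have : `|- s| <= r by rewrite normrN.
  move=> nsr; have := ab s (- s) sr nsr.
  have -> : b (s + - s) = 0 by rewrite subrr /b /fdiff scale0r addr0 mul0r !subrr.
  rewrite (ler0_norm s0) -/(b s) !ler_norml => /andP[? ?] /andP[? ?].
  by apply/andP; split; lra.
exists L => v vr; rewrite fdiff_coord -sumrB.
apply: (le_trans (ler_norm_sum _ _ _)).
rewrite -[X in X%:R * _](card_ord d) mulr_natl -sumr_const; apply: ler_sum => i _.
have vi : `|v ord0 i| <= r by apply: le_trans vr; exact: ler_coord_norm.
set e := v ord0 i *: unitv i.
have -> : fdiff e g (x + trunc_row i v) - v ord0 i * L i =
   fdiff (trunc_row i v) (fdiff e g) x + (fdiff e g x - v ord0 i * L i).
  by rewrite /fdiff; lra.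
apply: (le_trans (ler_normD _ _)).
have -> : 5 * w = w + 4 * w by lra.
apply: lerD; last exact: line.
apply: gw; first exact: le_trans (norm_trunc_row _ _) vr.
by apply: le_trans vi; exact: norm_unitv.
Qed.

End ZygmundGeometry.

(** * Estimates on dilates: Hoelder and Zygmund functions *)

Section Estimates.
Context {R : realType} {d : nat}.
Local Notation V := 'rV[R]_d.
Implicit Types (f g : V -> R) (x y v : V) (I : (V -> R) -> R) (b h u : R).

(** Here b is the order of smoothness of f, and the exponents q and p measure what
    is gained over the size h^b of a dilate when f is shifted by less than h, or
    averaged over a cube of side larger than h. That they are positive makes the
    integrals against dh/h converge at the scale of the shift or of the cube. The
    term u / h is the price of averaging over a grid of mesh u only. *)
Definition size_estimate I f b := exists2 C : R, 0 <= C &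
  forall x h, 0 < h -> `|dil I f x h| <= C * h `^ b.

Definition shift_estimate I f b (q : R) := exists2 C : R, 0 <= C &
  forall x y h, 0 < h -> `|y| <= h ->
    `|dil I f (x + y) h - dil I f x h| <= C * (h `^ b * (`|y| / h) `^ q).

Definition avg_estimate I f b (p q : R) := exists2 C : R, 0 <= C &
  forall x h u k, 0 < h -> 0 < u ->
    `|dil I (cubeavg u k f) x h|
    <= C * (h `^ b * ((h / (2 ^+ k * u)) `^ p + (u / h) `^ q)).

Lemma cubeavg_modulus_vec u k f (c1 c2 : R) v : 0 < u -> 0 <= c1 ->
  (forall i x, `|fdiff ((2 ^+ k * u) *: unitv i) f x| <= c1) ->
  (forall i r, 0 <= r <= u -> forall x, `|fdiff (r *: unitv i) f x| <= c2) ->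
  forall x, `|fdiff v (cubeavg u k f) x| <= d%:R * (`|v| / (2 ^+ k * u) * c1 + c2).
Proof.
move=> u0 c10 f1 f2 x; rewrite fdiff_coord; apply: (le_trans (ler_norm_sum _ _ _)).
rewrite -[X in X%:R * _](card_ord d) mulr_natl -sumr_const; apply: ler_sum => i _.
apply: (le_trans (cubeavg_modulus _ u0 c10 (f1 i) (f2 i) _)).
by rewrite lerD2r ler_wpM2r // ler_wpM2r ?ler_coord_norm // invr_ge0 mulr_ge0 ?exprn_ge0 // ltW.
Qed.

Lemma powR_inv (s r : R) : 0 <= s -> (s^-1) `^ r = (s `^ r)^-1.
Proof. by move=> s0; rewrite -powR_inv1 // -powRrM mulN1r powRN. Qed.

Section Base.
Variables (I : (V -> R) -> R) (rho B : R).
Hypothesis bI : bounded_functional I rho B.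

Section Hoelder.
Variables (f : V -> R) (a C : R).
Hypotheses (cf : continuous f) (a0 : 0 < a) (C0 : 0 <= C).
Hypothesis fH : forall y x, `|fdiff y f x| <= C * `|y| `^ a.

Let le_pow s t : 0 <= s -> s <= t -> s `^ a <= t `^ a.
Proof.
move=> s0 st; apply: ge0_ler_powR; rewrite ?nnegrE //; first exact: ltW.
exact: le_trans st.
Qed.

Lemma hoelder_size p : kills p I -> size_estimate I f a.
Proof.
move=> kI; exists (B * (C * rho `^ a)).
  by rewrite !mulr_ge0 ?powR_ge0 ?(bf_B bI).
move=> x h h0; rewrite -!mulrA -powRM ?(ltW h0) ?(ltW (bf_rho bI)) //.
apply: (dil_osc_bound bI _ kI) => // w wr; apply: (le_trans (fH _ _)).
rewrite ler_wpM2l // le_pow // normrZ (gtr0_norm h0) mulrC.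
by rewrite ler_wpM2r // ltW.
Qed.

Lemma hoelder_shift : shift_estimate I f a a.
Proof.
exists (B * C); first by rewrite mulr_ge0 ?(bf_B bI).
move=> x y h h0 yh; rewrite -(dil_fdiff bI) // -powRM ?divr_ge0 ?(ltW h0) //.
rewrite [h * _]mulrC divfK ?gt_eqF // -mulrA.
by apply: (dil_bound bI) => //; exact: continuous_fdiff.
Qed.

(** Averaging at scale l makes f Lipschitz with constant l^(a-1) below that scale. *)
Lemma hoelder_avg p : kills p I -> avg_estimate I f a (1 - a) a.
Proof.
move=> kI.
have rho0 := bf_rho bI; have B0 := bf_B bI.
exists (B * (d%:R * (C * (rho + 1)))).
  by rewrite !mulr_ge0 // addr_ge0 // ltW.
move=> x h u k h0 u0; set l := 2 ^+ k * u.
have l0 : 0 < l by rewrite mulr_gt0 ?exprn_gt0.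
rewrite -mulrA; apply: (dil_osc_bound bI _ kI) => [|w wr].
  exact: continuous_cubeavg.
apply: (@le_trans _ _ (d%:R * (`|h *: w| / l * (C * l `^ a) + C * u `^ a))).
  apply: cubeavg_modulus_vec => //; first by rewrite mulr_ge0 ?powR_ge0.
    move=> i y; apply: (le_trans (fH _ _)); rewrite ler_wpM2l // le_pow //.
    by apply: (le_trans (norm_unitv _ _)); rewrite gtr0_norm.
  move=> i r /andP[r0 ru] y; apply: (le_trans (fH _ _)); rewrite ler_wpM2l // le_pow //.
  by apply: (le_trans (norm_unitv _ _)); rewrite ger0_norm.
rewrite -[X in _ <= X]mulrA ler_wpM2l //.
have hl : h / l * l `^ a = h `^ a * (h / l) `^ (1 - a).
  have -> : l `^ a = h `^ a * (h / l) `^ (- a).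
    rewrite powRN powRM ?invr_ge0 ?(ltW h0) ?(ltW l0) // powR_inv ?(ltW l0) //.
    by field; rewrite !gt_eqF ?powR_gt0.
  have hl0 : 0 < h / l by rewrite divr_gt0.
  by rewrite mulrCA powRD ?(powRr1 (ltW hl0)) // (gt_eqF hl0) implybT.
have hu : u `^ a = h `^ a * (u / h) `^ a.
  by rewrite -powRM ?divr_ge0 ?(ltW h0) ?(ltW u0) // mulrC divfK // gt_eqF.
rewrite hu [h `^ a * (_ + _)]mulrDr; set P := _ * (h / l) `^ _ in hl *; set Q := _ * (u / h) `^ _.
have P0 : 0 <= P by rewrite mulr_ge0 ?powR_ge0.
have Q0 : 0 <= Q by rewrite mulr_ge0 ?powR_ge0.
have : `|h *: w| / l * (C * l `^ a) <= C * (rho * P).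
  rewrite mulrCA ler_wpM2l // -hl normrZ gtr0_norm // -!mulrA [rho * _]mulrCA.
  rewrite ler_wpM2l ?(ltW h0) // ler_wpM2r //.
  by rewrite mulr_ge0 ?invr_ge0 ?powR_ge0 // ltW.
have := mulr_ge0 C0 P0; have := mulr_ge0 (mulr_ge0 C0 (ltW rho0)) Q0; lra.
Qed.

End Hoelder.

Section Zygmund.
Variables (f : V -> R) (C : R).
Hypotheses (cf : continuous f) (C0 : 0 <= C).
Hypothesis fZ : forall y z x, `|fdiff y (fdiff z f) x| <= C * Num.sqrt (`|y| * `|z|).
Hypothesis kI : kills 1 I.

Let rho0 := bf_rho bI.
Let B0 := bf_B bI.

Let fZ_le y z x s : `|y| * `|z| <= s -> `|fdiff y (fdiff z f) x| <= C * Num.sqrt s.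
Proof.
move=> yz; apply: (le_trans (fZ _ _ _)); rewrite ler_wpM2l //.
by rewrite ler_sqrt // (le_trans _ yz) // mulr_ge0.
Qed.

Lemma affine_dil_bound g w x h : continuous g -> 0 < h -> 0 <= w ->
  (forall y z x, `|y| <= h * rho -> `|z| <= h * rho -> `|fdiff y (fdiff z g) x| <= w) ->
  `|dil I g x h| <= B * (d%:R * (5 * w)).
Proof.
move=> cg h0 w0 gw; have [L HL] := affine_approximation cg (mulr_gt0 h0 rho0) w0 gw x.
by apply: (dil_affine_bound bI cg kI (L := L)); rewrite gtr0_norm.
Qed.

Lemma zygmund_size : size_estimate I f 1.
Proof.
exists (B * (d%:R * (5 * (C * rho)))); first by rewrite !mulr_ge0 // ltW.
move=> x h h0; rewrite powRr1 ?(ltW h0) // -!mulrA [rho * h]mulrC.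
apply: affine_dil_bound => // [|y z x' yr zr].
  by rewrite !mulr_ge0 // ltW.
have -> : h * rho = Num.sqrt ((h * rho) * (h * rho)).
  by rewrite -expr2 sqrtr_sqr gtr0_norm // mulr_gt0.
by apply: fZ_le; rewrite ler_pM.
Qed.

Lemma zygmund_shift : shift_estimate I f 1 2^-1.
Proof.
exists (B * (C * Num.sqrt rho)); first by rewrite !mulr_ge0 ?sqrtr_ge0.
move=> x y h h0 yh; rewrite -(dil_fdiff bI) // powRr1 ?(ltW h0) // powR12_sqrt; last first.
  by rewrite divr_ge0 // ltW.
have -> : h * Num.sqrt (`|y| / h) = Num.sqrt (h * `|y|).
  rewrite -{1}[h](gtr0_norm h0) -sqrtr_sqr -sqrtrM ?sqr_ge0 //; congr Num.sqrt.
  by field; rewrite gt_eqF.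
rewrite -!mulrA -sqrtrM; last exact: ltW.
apply: (dil_osc_bound bI _ kI) => [|w wr]; first exact: continuous_fdiff.
apply: fZ_le; rewrite normrZ gtr0_norm // mulrA [rho * h]mulrC.
by rewrite ler_wpM2r // ler_wpM2l // ltW.
Qed.

(** Below the scale l of the averages the mixed differences with both steps of
    length h improve from h to (h / l) sqrt(l h), as one of the two steps may be
    taken at the scale l. *)
Lemma zygmund_avg : avg_estimate I f 1 2^-1 2^-1.
Proof.
exists (B * (d%:R * (5 * (d%:R * (C * Num.sqrt rho * (rho + 1)))))).
  by rewrite !mulr_ge0 ?sqrtr_ge0 // addr_ge0 // ltW.
move=> x h u k h0 u0; set l := 2 ^+ k * u.
have l0 : 0 < l by rewrite mulr_gt0 ?exprn_gt0.
have hr0 : 0 < h * rho by rewrite mulr_gt0.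
pose w := d%:R * ((h * rho) / l * (C * Num.sqrt (l * (h * rho))) + C * Num.sqrt (u * (h * rho))).
have w0 : 0 <= w.
  by rewrite !(mulr_ge0, addr_ge0) ?sqrtr_ge0 ?invr_ge0 // ltW.
have cS : continuous (cubeavg u k f) by exact: continuous_cubeavg.
have := @affine_dil_bound (cubeavg u k f) w x h cS h0 w0.
have hyp y z x' : `|y| <= h * rho -> `|z| <= h * rho ->
    `|fdiff y (fdiff z (cubeavg u k f)) x'| <= w.
  move=> yr zr.
  have -> : fdiff z (cubeavg u k f) = cubeavg u k (fdiff z f).
    by apply/funext => x''; rewrite cubeavg_fdiff.
  apply: (@le_trans _ _ (d%:R * (`|y| / l * (C * Num.sqrt (l * (h * rho))) + C * Num.sqrt (u * (h * rho))))).
    apply: cubeavg_modulus_vec => //; first by rewrite mulr_ge0 ?sqrtr_ge0.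
      move=> i x''; apply: fZ_le; rewrite ler_pM //.
      by apply: (le_trans (norm_unitv _ _)); rewrite gtr0_norm.
    move=> i r /andP[r0 ru] x''; apply: fZ_le; rewrite ler_pM //.
    by apply: (le_trans (norm_unitv _ _)); rewrite ger0_norm.
  rewrite ler_wpM2l // lerD2r ler_wpM2r ?mulr_ge0 ?sqrtr_ge0 //.
  by rewrite ler_wpM2r // invr_ge0 ltW.
move=> /(_ hyp) H; apply: (le_trans H) => {H hyp}; rewrite -!mulrA ler_wpM2l // ler_wpM2l // ler_wpM2l //.
rewrite /w; clearbody l; rewrite ler_wpM2l // powRr1 ?(ltW h0) // !powR12_sqrt ?divr_ge0 ?(ltW h0) ?(ltW u0) ?(ltW l0) //.
rewrite !sqrtrM ?(ltW h0) ?(ltW u0) ?(ltW l0) // !sqrtrV ?(ltW h0) ?(ltW l0) //.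
move: (sqr_sqrtr (ltW h0)) (sqr_sqrtr (ltW l0)).
have : 0 < Num.sqrt h by rewrite sqrtr_gt0.
have : 0 < Num.sqrt l by rewrite sqrtr_gt0.
have := sqrtr_ge0 rho; have := sqrtr_ge0 u.
set a := Num.sqrt h; set b := Num.sqrt l; set e := Num.sqrt u; set s := Num.sqrt rho.
move=> e0 s0 b0 a0 ha lb; rewrite -ha -lb.
have -> : a ^+ 2 * rho / b ^+ 2 * (C * (b * (a * s))) = C * s * (rho * (a ^+ 3 / b)).
  by field; rewrite gt_eqF.
have -> : C * (s * ((rho + 1) * (a ^+ 2 * (a * b^-1 + e * a^-1)))) =
          C * s * ((rho + 1) * (a ^+ 3 / b + e * a)).
  by field; rewrite !gt_eqF.
have : 0 <= C * s * (a ^+ 3 / b).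
  by rewrite !mulr_ge0 ?invr_ge0 ?exprn_ge0 // ltW.
have : 0 <= C * s * (rho * (e * a)) by rewrite !mulr_ge0 // ltW.
lra.
Qed.

End Zygmund.
End Base.
End Estimates.

(** * Differentiation under a compactly supported functional *)

Section MeanValue.
Context {R : realType} {d : nat}.
Local Notation V := 'rV[R]_d.
Implicit Types (f g : V -> R) (x y v w : V) (I : (V -> R) -> R).

Definition C1 f : Prop :=
  (forall x, differentiable f x) /\ forall i, continuous (partial i f).

Lemma C1_continuous f : C1 f -> continuous f.
Proof. by move=> [df _] x; exact: differentiable_continuous. Qed.

Lemma derive_partials f x v : differentiable f x ->
  'D_v f x = \sum_i v ord0 i * partial i f x.
Proof.
move=> df; rewrite deriveE //.
have -> : v = \sum_i v ord0 i *: unitv i.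
  by rewrite {1}(row_sum_delta v).
rewrite linear_sum; apply: eq_bigr => i _ /=.
by rewrite linearZ /= -deriveE // -row_sum_delta.
Qed.

Lemma is_derive_line f x v t : differentiable f (x + t *: v) ->
  is_derive t 1 (fun t : R => f (x + t *: v)) ('D_v f (x + t *: v)).
Proof.
move=> df.
have E : (fun h : R => h^-1 *: (((fun t : R => f (x + t *: v)) \o shift t) (h *: 1) - f (x + t *: v))) =
   (fun h : R => h^-1 *: ((f \o shift (x + t *: v)) (h *: v) - f (x + t *: v))).
  apply/funext => h /=; congr (_ *: (f _ - _)).
  by rewrite [h *: 1]mulr1 scalerDl addrCA.
have dv := diff_derivable (v := v) df.
split; first by rewrite /derivable E.
by rewrite /derive E.
Qed.

Lemma closed_ball_norm (rho : R) : closed [set w : V | `|w| <= rho].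
Proof.
rewrite (_ : [set w | _] = Num.norm @^-1` [set r | r <= rho]) //.
by apply: closed_comp; [move=> ? _; exact: norm_continuous|exact: closed_le].
Qed.

Lemma compact_ball_norm (rho : R) : compact [set w : V | `|w| <= rho].
Proof.
apply: bounded_closed_compact; last exact: closed_ball_norm.
exists rho; split; first exact: num_real.
by move=> M rM w /= /le_trans; apply; exact: ltW.
Qed.

Lemma uniform_near_compact (rho : R) (H : R -> V -> R) t e : 0 < e ->
  continuous (fun z : R * V => H z.1 z.2) ->
  \forall s \near t, forall w, `|w| <= rho -> `|H s w - H t w| <= e.
Proof.
move=> e0 cH.
have cK : compact [set w : V | `|w| <= rho] by exact: compact_ball_norm.
move/compact_near_coveringP : cK => /(_ R (nbhs t) (fun s w => `|H s w - H t w| <= e)).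
apply => w _.
have c1 := cH (t, w); have e2 : 0 < e / 2 by rewrite divr_gt0.
have [[A1 A2] [/= nA1 nA2] HA] : nbhs (t, w) [set z | `|H t w - H z.1 z.2| <= e / 2].
  by move/cvgrPdist_le : c1 => /(_ _ e2).
exists (A2, A1) => //= -[w' s] /= [w'A sA].
have h1 := HA (s, w') (conj sA w'A).
have h2 := HA (t, w') (conj (nbhs_singleton nA1) w'A).
move: h1 h2 => /=; rewrite !ler_norml => /andP[? ?] /andP[? ?].
by apply/andP; split; lra.
Qed.

Lemma continuous_pairR (s : R) : continuous (fun w : V => (s, w)).
Proof.
move=> w; apply: (@cvg_pair _ _ _ (nbhs w) (nbhs s) (nbhs w) _ _ _ (fun=> s) id).
  exact: cvg_cst.
exact: cvg_id.
Qed.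

Section Bounded.
Variables (I : (V -> R) -> R) (rho B : R).
Hypothesis bI : bounded_functional I rho B.

(** The difference quotients converge uniformly on the ball that carries I: by
    the mean value theorem each is a value of G at a nearby parameter. *)
Lemma bf_is_derive (F G : R -> V -> R) (t : R) :
  (forall s, continuous (F s)) -> continuous (fun z : R * V => G z.1 z.2) ->
  (forall (s : R) w, is_derive s 1 (F ^~ w) (G s w)) ->
  is_derive t 1 (fun s => I (F s)) (I (G t)).
Proof.
move=> cF cG FG.
have cGs s : continuous (G s).
  move=> w; apply: (@continuous_comp _ _ _ (fun w : V => (s, w)) (fun z : R * V => G z.1 z.2)).
    exact: continuous_pairR.
  exact: cG.
suff cv : (fun h : R => h^-1 *: (((fun s => I (F s)) \o shift t) (h *: 1) - I (F t))) @ 0^' --> I (G t).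
  by split; [apply/cvg_ex; exists (I (G t))|exact/cvg_lim].
apply/cvgrPdist_le => e e0.
have B1 : 0 < B + 1 by have := bf_B bI; lra.
have e1 : 0 < e / (B + 1) by rewrite divr_gt0.
have [r /= r0 Hr] := uniform_near_compact rho t e1 cG.
exists r => //= h /= + hne; rewrite sub0r normrN => hr.
have -> : h *: (1 : R) = h by rewrite [LHS]mulr1.
have -> : I (G t) - h^-1 *: (I (F (h + t)) - I (F t)) =
  I (fun w => G t w - h^-1 * (F (h + t) w - F t w)).
  rewrite (bfB bI) ?(bfZ bI) ?(bfB bI) //.
    exact: continuousBf.
  by apply: continuousMf; [exact: continuous_cstf|exact: continuousBf].
apply: (@le_trans _ _ (B * (e / (B + 1)))); last first.
  rewrite mulrA ler_pdivrMr // mulrC; apply: ler_pM => //; [exact: ltW|exact: bf_B bI|lra].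
apply: (bf_bound bI).
  apply: continuousBf => //.
  by apply: continuousMf; [exact: continuous_cstf|exact: continuousBf].
move=> w wr.
have dF (s : R) : derivable (F ^~ w) s 1 by exact: @ex_derive.
have cFw : {within `[Num.min t (h + t), Num.max t (h + t)], continuous (F ^~ w)}.
  by apply: derivable_within_continuous => s _; exact: dF.
have mm : Num.min t (h + t) <= Num.max t (h + t).
  by rewrite ge_min le_max lexx.
have [c /[!in_itv]/= /andP[c1 c2] cE] := MVT_segment mm (fun s _ => FG s w) cFw.
have -> : h^-1 * (F (h + t) w - F t w) = G c w.
  move: cE; case: (lerP t (h + t)) => ht E.
    by rewrite E addrK mulrC mulfK.
  have -> : F (h + t) w - F t w = - (F t w - F (h + t) w) by rewrite opprB.
  rewrite E; field; exact: hne.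
rewrite distrC; apply: Hr => //=.
move: c1 c2; rewrite ge_min le_max distrC.
move: hr; rewrite !ltr_norml => /andP[h1 h2].
case: (lerP t (h + t)) => ht; case: (leP t c); case: (leP c (h + t)) => /= ? ? ? ?; apply/andP; split; lra.
Qed.

(** The mean value theorem along a family of segments: the intermediate
    parameter is common to all of them because it is found for the integral. *)
Lemma bf_mean_value f (p q : V -> V) : C1 f -> continuous p -> continuous q ->
  exists2 c, 0 < c < 1 &
    I (fun w => f (p w + q w)) - I (fun w => f (p w)) =
    \sum_i I (fun w => q w ord0 i * partial i f (p w + c *: q w)).
Proof.
move=> [df pf] cp cq.
pose F (s : R) w := f (p w + s *: q w).
pose G (s : R) w := \sum_i q w ord0 i * partial i f (p w + s *: q w).
have cf : continuous f by apply: C1_continuous.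
have cl : continuous (fun z : R * V => p z.2 + z.1 *: q z.2).
  move=> z; apply: (@continuousD _ _ _ (fun z : R * V => p z.2) (fun z : R * V => z.1 *: q z.2)).
    by apply: (@continuous_comp _ _ _ snd p); [exact: cvg_snd|exact: cp].
  apply: continuousZ; first exact: cvg_fst.
  by apply: (@continuous_comp _ _ _ snd q); [exact: cvg_snd|exact: cq].
have cls s : continuous (fun w => p w + s *: q w).
  move=> w; apply: (@continuous_comp _ _ _ (fun w : V => (s, w)) (fun z : R * V => p z.2 + z.1 *: q z.2)).
    exact: continuous_pairR.
  exact: cl.
have cq' i : continuous (fun w => q w ord0 i).
  move=> w; apply: (@continuous_comp _ _ _ q (fun w : V => w ord0 i)); first exact: cq.
  exact: continuous_coord.
have cpc i s : continuous (fun w => q w ord0 i * partial i f (p w + s *: q w)).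
  apply: continuousMf => // w.
  by apply: (@continuous_comp _ _ _ (fun w => p w + s *: q w)); [exact: cls|exact: pf].
have cF s : continuous (F s).
  by move=> w; apply: (@continuous_comp _ _ _ (fun w => p w + s *: q w)); [exact: cls|exact: cf].
have cG : continuous (fun z : R * V => G z.1 z.2).
  rewrite /G; elim: (index_enum _) => [|i r IH].
    by under eq_fun do rewrite big_nil; exact: cst_continuous.
  under eq_fun do rewrite big_cons.
  move=> z; apply: (@continuousD _ _ _ (fun z : R * V => q z.2 ord0 i * partial i f (p z.2 + z.1 *: q z.2))); last exact: IH.
  apply: (@continuousM _ _ (fun z : R * V => q z.2 ord0 i)).
    by apply: (@continuous_comp _ _ _ snd (fun w => q w ord0 i)); [exact: cvg_snd|exact: cq'].
  by apply: (@continuous_comp _ _ _ (fun z : R * V => p z.2 + z.1 *: q z.2) (partial i f)); [exact: cl|exact: pf].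
have FG (s : R) w : is_derive s 1 (F ^~ w) (G s w).
  rewrite /G -derive_partials //; exact: is_derive_line.
have dI s := @bf_is_derive F G s cF cG FG.
have cI : {within `[0, 1], continuous (fun s => I (F s))}.
  apply: derivable_within_continuous => s _; exact: @ex_derive.
have [c /[!in_itv]/= c01 cE] := MVT (@ltr01 R) (fun s _ => dI s) cI.
exists c => //; move: cE; rewrite subr0 mulr1 /F /G.
under eq_fun do rewrite scale1r.
rewrite (_ : (fun w => f (p w + 0 *: q w)) = (fun w => f (p w))); last first.
  by apply/funext => w; rewrite scale0r addr0.
move=> ->; by rewrite (bf_sum bI).
Qed.

End Bounded.
End MeanValue.

(** * Estimates on dilates: all orders of smoothness *)

Section Classes.
Context {R : realType} {d : nat}.
Local Notation V := 'rV[R]_d.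
Implicit Types (f g : V -> R) (x y v w : V) (I : (V -> R) -> R) (a : R).

Lemma enorm_ge0 v : 0 <= enorm v.
Proof. exact: sqrtr_ge0. Qed.

Lemma norm_le_enorm v : `|v| <= enorm v.
Proof.
apply: norm_rV_le => [|i]; first exact: enorm_ge0.
rewrite -sqrtr_sqr ler_sqrt ?sumr_ge0 // => [|j _]; last exact: sqr_ge0.
by rewrite (bigD1 i) //= lerDl sumr_ge0 // => j _; exact: sqr_ge0.
Qed.

Lemma enorm_le_norm v : enorm v <= d%:R * `|v|.
Proof.
rewrite -[leRHS]ger0_norm ?mulr_ge0 // -sqrtr_sqr ler_sqrt ?sqr_ge0 //.
apply: (@le_trans _ _ (\sum_(i < d) `|v| ^+ 2)).
  apply: ler_sum => i _; rewrite -[v ord0 i ^+ 2]ger0_norm ?sqr_ge0 // normrX.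
  by rewrite lerXn2r ?nnegrE ?ler_coord_norm.
rewrite sumr_const card_ord -[leLHS]mulr_natl exprMn ler_wpM2r ?sqr_ge0 //.
by rewrite -natrX ler_nat; case: (d) => // n; rewrite expnS expn1 leq_pmulr.
Qed.

Lemma ereal_sup_ltyP (S : set (\bar R)) : (ereal_sup S < +oo)%E ->
  exists2 M : R, 0 <= M & forall r, S r%:E -> r <= M.
Proof.
move=> Sy; exists (Num.max 0 (fine (ereal_sup S))); first by rewrite le_max lexx.
move=> r Sr; rewrite le_max; apply/orP; right.
have := ereal_sup_ubound Sr.
by case: (ereal_sup S) Sy => [t| |] //= _; rewrite ?lee_fin // leeNy_eq.
Qed.

Lemma holder_bound a g : 0 < a -> holder_class a g ->
  exists2 C, 0 <= C & forall y x, `|fdiff y g x| <= C * `|y| `^ a.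
Proof.
move=> a0 /ereal_sup_ltyP[M M0 HM]; exists (M * d%:R `^ a).
  by rewrite mulr_ge0 // powR_ge0.
move=> y x; have [->|y0] := eqVneq y 0.
  by rewrite /fdiff addr0 subrr normr0 !mulr_ge0 ?powR_ge0.
have ey : 0 < enorm y by apply: lt_le_trans (norm_le_enorm y); rewrite normr_gt0.
have := HM (`|fdiff y g x| / enorm y `^ a) _; rewrite ler_pdivrMr ?powR_gt0 // => H.
apply: (le_trans (H _)); first by exists x => //; exists y.
rewrite -mulrA ler_wpM2l // -powRM //.
by apply: ge0_ler_powR; rewrite ?nnegrE ?(ltW a0) ?(ltW ey) ?mulr_ge0 ?enorm_le_norm.
Qed.

Lemma holder_continuous a g : 0 < a -> holder_class a g -> continuous g.
Proof.
move=> a0 /(holder_bound a0)[C C0 gC] x; apply/(@cvgrPdist_le _ _ _ (nbhs x)) => e e0.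
have C1 : 0 < C + 1 by lra.
pose r := (e / (C + 1)) `^ a^-1.
have r0 : 0 < r by rewrite powR_gt0 // divr_gt0.
near=> y; have -> : g x - g y = - fdiff (y - x) g x by rewrite /fdiff subrKC opprB.
rewrite normrN; apply: (le_trans (gC _ _)).
have yx : `|y - x| <= r.
  rewrite distrC; near: y; apply: (@cvgr_dist_le _ _ _ (nbhs x) _ id x); first exact: cvg_id.
  exact: r0.
apply: (@le_trans _ _ (C * (e / (C + 1)))).
  rewrite ler_wpM2l //; apply: (@le_trans _ _ (r `^ a)).
    by apply: ge0_ler_powR; rewrite ?nnegrE ?(ltW a0) ?(ltW r0).
  by rewrite /r -powRrM mulVf ?gt_eqF // powRr1 // divr_ge0 // ltW.
rewrite mulrA ler_pdivrMr // mulrC ler_wpM2l // ?(ltW e0) //; lra.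
Unshelve. all: by end_near. Qed.

Lemma zygmund_bound g : zygmund_class g ->
  exists2 C, 0 <= C &
    forall x v, `|g (x + v) + g (x - v) - 2 * g x| <= C * `|v|.
Proof.
move=> [_ /ereal_sup_ltyP[M M0 HM]]; exists (M * d%:R); first by rewrite mulr_ge0.
move=> x y; have [->|y0] := eqVneq y 0.
  rewrite subr0 addr0 normr0 mulr0 (_ : _ - _ = 0) ?normr0 //; lra.
have ey : 0 < enorm y by apply: lt_le_trans (norm_le_enorm y); rewrite normr_gt0.
have := HM (`|g (x + y) + g (x - y) - 2 * g x| / enorm y) _.
rewrite ler_pdivrMr // => H; apply: (le_trans (H _)); first by exists x => //; exists y.
by rewrite -mulrA ler_wpM2l // enorm_le_norm.
Qed.

Lemma Lambda_continuous a g : 0 < a -> Lambda a g -> continuous g.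
Proof.
by move=> a0; rewrite /Lambda; case: eqP => _; [case|exact: holder_continuous].
Qed.

Lemma C_class_partial m a f i : C_class m.+1 a f -> C_class m a (partial i f).
Proof.
move=> [[_ tf] Lf]; split=> [|s]; first exact: tf.
have := Lf [tuple of rcons s i]; congr Lambda.
by rewrite /= foldr_rcons.
Qed.

Lemma C_class_continuous m a f : 0 < a -> C_class m a f -> continuous f.
Proof.
move=> a0; case: m => [[_ /(_ [tuple])]|m [[df _] _] x]; first exact: Lambda_continuous.
exact: differentiable_continuous.
Qed.

Lemma C_class_C1 m a f : 0 < a -> C_class m.+1 a f -> C1 f.
Proof.
move=> a0 Cf; split; first by case: Cf => -[].
by move=> i; apply: (@C_class_continuous m a) => //; exact: C_class_partial.
Qed.

(** Averaging commutes with differentiation, being a finite mean of translations. *)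
Lemma C1_cmean (F : {ffun 'I_d -> bool} -> V -> R) : (forall e, C1 (F e)) ->
  C1 (fun x => cmean (F ^~ x)) /\
  forall i x, partial i (fun x => cmean (F ^~ x)) x = cmean (fun e => partial i (F e) x).
Proof.
move=> CF.
have E : (fun x => cmean (F ^~ x)) = (2 ^+ d)^-1 \*: (\sum_e F e).
  by apply/funext => x; rewrite /cmean /= fct_sumE.
have dS : forall x, differentiable (\sum_e F e) x.
  move=> x; elim/big_ind: _ => [|g h dg dh|e _]; first exact: differentiable_cst.
    exact: differentiableD.
  exact: (CF e).1.
have pE i x : partial i (fun x => cmean (F ^~ x)) x = cmean (fun e => partial i (F e) x).
  have dv e : derivable (F e) x (delta_mx ord0 i) by apply: diff_derivable; exact: (CF e).1.
  rewrite /partial E deriveZ; last by apply: diff_derivable; exact: dS.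
  congr (_ * _); elim: (index_enum _) => [|e r IH].
    by rewrite !big_nil; exact: derive_cst.
  rewrite !big_cons deriveD ?IH //; apply: diff_derivable.
  elim/big_ind: _ => [|g h dg dh|j _]; first exact: differentiable_cst.
    exact: differentiableD.
  exact: (CF j).1.
split => //; split=> [x|i].
  by rewrite E; apply: differentiableZ; exact: dS.
have -> : partial i (fun x => cmean (F ^~ x)) = fun x => cmean (fun e => partial i (F e) x).
  by apply/funext.
by apply: (@continuous_cmean _ _ (fun e x => partial i (F e) x)) => e; exact: (CF e).2.
Qed.

Lemma partial_shift i f v x : partial i (fun x => f (x + v)) x = partial i f (x + v).
Proof.
rewrite /partial /derive.
rewrite (_ : (fun h : R => _) = fun h : R =>
   h^-1 *: ((f \o shift (x + v)) (h *: (delta_mx ord0 i : V)) - f (x + v))) //.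
by apply/funext => h /=; rewrite addrA.
Qed.

Lemma C1_shift f v : C1 f -> C1 (fun x => f (x + v)).
Proof.
move=> [df pf]; split=> [x|i].
  apply: (@differentiable_comp _ _ _ _ (fun x => x + v) f); last exact: df.
  exact: differentiableD.
have -> : partial i (fun x => f (x + v)) = fun x => partial i f (x + v).
  by apply/funext => x; exact: partial_shift.
exact: continuous_shift.
Qed.

Lemma C1_cubeavg u k f : C1 f ->
  C1 (cubeavg u k f) /\ forall i, partial i (cubeavg u k f) = cubeavg u k (partial i f).
Proof.
move=> Cf; elim: k => [//|k [C1k pk]] /=.
have [|C1m pm] := @C1_cmean (fun e x => cubeavg u k f (x + (2 ^+ k * u) *: bits e)).
  by move=> e; exact: C1_shift.
split=> // i; apply/funext => x.
by rewrite pm; apply: eq_cmean => e; rewrite partial_shift pk.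
Qed.

(** Differentiating a dilate in h brings down a factor w i; the functional that
    absorbs it kills one degree less. *)
Definition weighted i I : (V -> R) -> R := fun g => I (fun w => w ord0 i * g w).

Section Bounded.
Variables (I : (V -> R) -> R) (rho B : R).
Hypothesis bI : bounded_functional I rho B.

Lemma bounded_weighted i : bounded_functional (weighted i I) rho (B * rho).
Proof.
have rho0 := bf_rho bI.
have cw g : continuous g -> continuous (fun w => w ord0 i * g w).
  by move=> cg; apply: continuousMf => //; exact: continuous_coord.
split=> //.
- by rewrite mulr_ge0 ?(bf_B bI) // ltW.
- move=> f g cf cg; rewrite /weighted -(bfD bI); [|exact: cw..].
  by congr (I _); apply/funext => w; rewrite mulrDr.
- move=> c f cf; rewrite /weighted -(bfZ bI); last exact: cw.
  by congr (I _); apply/funext => w; rewrite mulrCA.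
- move=> f c cf fc; rewrite -mulrA; apply: (bf_bound bI); first exact: cw.
  move=> w wr; rewrite normrM ler_pM //; last exact: fc.
  exact: le_trans (ler_coord_norm _ _) wr.
Qed.

Lemma kills_weighted p i : kills p.+1 I -> kills p (weighted i I).
Proof.
move=> kI k kp; rewrite /weighted.
rewrite (_ : (fun w => _) = monomial (fun j => ((j == i) + k j)%N)).
  apply: kI; rewrite big_split /= -add1n leq_add //.
  by rewrite (bigD1 i) //= eqxx big1 // => j /negbTE ->.
apply/funext => w; rewrite -monomial1 /monomial -big_split /=.
by apply: eq_bigr => j _; rewrite exprD.
Qed.

(** The dilate vanishes at h = 0 because I kills constants. *)
Lemma dil_mean_value p f x h : C1 f -> kills p I ->
  exists2 c, 0 < c < 1 &
    dil I f x h = h * \sum_i dil (weighted i I) (partial i f) x (c * h).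
Proof.
move=> Cf kI.
have [||c c01 E] := bf_mean_value bI (p := fun=> x) (q := fun w => h *: w) Cf.
- exact: cst_continuous.
- by move=> w; apply: continuousZl_tmp; exact: cvg_id.
exists c => //; move: E; rewrite (bf_kill_cst bI _ kI) subr0 /dil => ->.
rewrite mulr_sumr; apply: eq_bigr => i _.
rewrite /weighted -(bfZ bI); last first.
  apply: continuousMf; first exact: continuous_coord.
  by apply: continuous_dil_arg; exact: Cf.2.
by congr (I _); apply/funext => w; rewrite mxE scalerA mulrA.
Qed.

Lemma dil_shift_mean_value f x y h : C1 f ->
  exists2 c, 0 < c < 1 &
    dil I f (x + y) h - dil I f x h = \sum_i y ord0 i * dil I (partial i f) (x + c *: y) h.
Proof.
move=> Cf.
have [||c c01 E] := bf_mean_value bI (p := fun w => x + h *: w) (q := fun=> y) Cf.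
- exact: continuous_dilate.
- exact: cst_continuous.
exists c => //; rewrite /dil.
rewrite (_ : (fun w => f (x + y + h *: w)) = fun w => f (x + h *: w + y)); last first.
  by apply/funext => w; rewrite addrAC.
rewrite E; apply: eq_bigr => i _.
rewrite (bfZ bI); last first.
  move=> w; apply: (@continuous_comp _ _ _ (fun w => x + h *: w + c *: y) (partial i f)); last exact: Cf.2.
  apply: (@continuousD _ _ _ (fun w => x + h *: w) (fun=> c *: y)).
    exact: continuous_dilate.
  exact: cst_continuous.
congr (_ * I _); apply/funext => w; by rewrite addrAC.
Qed.

End Bounded.

End Classes.

Section Induction.
Context {R : realType} {d : nat}.
Local Notation V := 'rV[R]_d.
Implicit Types (f g : V -> R) (x y v w : V) (I : (V -> R) -> R) (a b : R).

(** For a = 1 any rate below 1 would do: the estimates in the Zygmund class lose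
    a logarithm. *)
Definition avg_rate a : R := if a == 1 then 2^-1 else 1 - a.
Definition shift_rate a : R := if a == 1 then 2^-1 else a.

Lemma avg_rate_gt0 a : a <= 1 -> 0 < avg_rate a.
Proof. by rewrite /avg_rate; case: eqVneq => [//|a1 ale]; rewrite subr_gt0 lt_neqAle a1. Qed.

Lemma shift_rate_gt0 a : 0 < a -> 0 < shift_rate a.
Proof. by rewrite /shift_rate; case: eqP. Qed.

Lemma shift_rate_le a : shift_rate a <= a.
Proof. by rewrite /shift_rate; case: eqVneq => [->|//]; lra. Qed.

Lemma estimates_order0 a I rho B f : 0 < a -> bounded_functional I rho B ->
  kills (a == 1) I -> C_class 0 a f ->
  [/\ size_estimate I f a, shift_estimate I f a (shift_rate a) &
      avg_estimate I f a (avg_rate a) (shift_rate a)].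
Proof.
move=> a0 bI kI Cf; have cf := C_class_continuous a0 Cf.
have := Cf.2 [tuple]; rewrite /= /Lambda; move: kI; rewrite /avg_rate /shift_rate.
case: eqVneq => [a1|a1] /= kI.
  move=> /zygmund_bound[C C0 /(zygmund_mixed C0) fZ].
  have C4 : 0 <= 4 * C by rewrite mulr_ge0.
  by rewrite a1; split;
    [apply: (zygmund_size bI)|apply: (zygmund_shift bI)|apply: (zygmund_avg bI)]; eassumption.
move=> /(holder_bound a0)[C C0 fH].
by split; [apply: (hoelder_size bI)|apply: (hoelder_shift bI)|apply: (hoelder_avg bI)]; eassumption.
Qed.

Lemma mulr_powR b (h : R) : 0 <= b -> 0 < h -> h * h `^ b = h `^ (1 + b).
Proof.
move=> b0 h0; rewrite powRD ?powRr1 ?(ltW h0) //.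
by rewrite (gt_eqF h0) implybT.
Qed.

Lemma uniform_constant (P : 'I_d -> R -> Prop) :
  (forall i C C', C <= C' -> P i C -> P i C') ->
  (forall i, exists2 C, 0 <= C & P i C) -> exists2 C, 0 <= C & forall i, P i C.
Proof.
move=> mP eP.
have [F HF] : {F : 'I_d -> R & forall i, 0 <= F i /\ P i (F i)}.
  by apply: (@choice _ _ (fun i C => 0 <= C /\ P i C)) => i; have [C C0 PC] := eP i; exists C.
exists (\sum_i F i); first by apply: sumr_ge0 => i _; case: (HF i).
move=> i; apply: mP (HF i).2.
by rewrite (bigD1 i) //= lerDl sumr_ge0 // => j _; case: (HF j).
Qed.

Lemma ler_norm_sum_const (F : 'I_d -> R) c :
  (forall i, `|F i| <= c) -> `|\sum_i F i| <= d%:R * c.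
Proof.
move=> Fc; apply: (le_trans (ler_norm_sum _ _ _)).
by rewrite -[X in X%:R * _](card_ord d) mulr_natl -sumr_const; apply: ler_sum.
Qed.

Section Step.
Variables (I : (V -> R) -> R) (rho B : R) (f : V -> R) (n : nat) (b p q : R).
Hypotheses (bI : bounded_functional I rho B) (kI : kills n I) (Cf : C1 f).
Hypotheses (b0 : 0 <= b) (p0 : 0 <= p) (q1 : q <= 1) (qb : q <= b).

Lemma size_step : (forall i, size_estimate (weighted i I) (partial i f) b) ->
  size_estimate I f (1 + b).
Proof.
move=> /uniform_constant[i C C' CC' H x h h0|C C0 HC].
  by apply: (le_trans (H x h h0)); rewrite ler_wpM2r ?powR_ge0.
exists (d%:R * C); first by rewrite mulr_ge0.
move=> x h h0; have [c /andP[c0 c1] ->] := dil_mean_value bI x h Cf kI.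
rewrite normrM gtr0_norm // -mulr_powR // mulrCA ler_wpM2l ?(ltW h0) // -mulrA.
apply: ler_norm_sum_const => i.
have ch : 0 < c * h by rewrite mulr_gt0.
apply: (le_trans (HC i x _ ch)); rewrite ler_wpM2l //.
apply: ge0_ler_powR; rewrite ?nnegrE ?(ltW ch) ?(ltW h0) //.
by rewrite ler_piMl ?(ltW h0) ?(ltW c1).
Qed.

(** A shift is paid for by one derivative, and the size of its dilate, which is
    of order h^b, leaves the full factor |y| / h. *)
Lemma shift_step : (forall i, size_estimate I (partial i f) b) ->
  shift_estimate I f (1 + b) q.
Proof.
move=> /uniform_constant[i C C' CC' H x h h0|C C0 HC].
  by apply: (le_trans (H x h h0)); rewrite ler_wpM2r ?powR_ge0.
exists (d%:R * C); first by rewrite mulr_ge0.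
move=> x y h h0 yh; have [c _ ->] := dil_shift_mean_value bI x y h Cf.
rewrite -mulr_powR // -!mulrA; apply: ler_norm_sum_const => i.
have yhq : `|y| / h <= (`|y| / h) `^ q.
  have [->|y0] := eqVneq y 0; first by rewrite normr0 mul0r powR_ge0.
  by apply: ger1_powR => //; rewrite divr_gt0 ?normr_gt0 //= ler_pdivrMr // mul1r.
rewrite normrM; apply: (@le_trans _ _ (`|y| * (C * h `^ b))).
  by rewrite ler_pM ?ler_coord_norm ?HC.
rewrite [leLHS]mulrC [leRHS](_ : _ = C * h `^ b * (h * (`|y| / h) `^ q)); last by ring.
rewrite ler_wpM2l ?mulr_ge0 ?powR_ge0 //.
apply: (@le_trans _ _ (h * (`|y| / h))); first by rewrite mulrC divfK // gt_eqF.
by rewrite ler_wpM2l // ltW.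
Qed.

(** The estimate at the intermediate scale c h implies the one at h since both
    terms, multiplied by h^b, increase with h; for the one in u / h this requires q <= b. *)
Lemma avg_step : (forall i, avg_estimate (weighted i I) (partial i f) b p q) ->
  avg_estimate I f (1 + b) p q.
Proof.
move=> /uniform_constant[i C C' CC' H x h u k h0 u0|C C0 HC].
  apply: (le_trans (H x h u k h0 u0)); rewrite ler_wpM2r //.
  by rewrite !(mulr_ge0, addr_ge0) ?powR_ge0.
exists (d%:R * C); first by rewrite mulr_ge0.
move=> x h u k h0 u0; have [CS pS] := C1_cubeavg u k Cf.
have [c /andP[c0 c1] ->] := dil_mean_value bI x h CS kI.
rewrite normrM gtr0_norm // -mulr_powR // -[h * _ * _]mulrA mulrCA ler_wpM2l ?(ltW h0) // -mulrA.
apply: ler_norm_sum_const => i; rewrite pS.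
have ch : 0 < c * h by rewrite mulr_gt0.
apply: (le_trans (HC i x _ u k ch u0)); rewrite ler_wpM2l //.
set l := 2 ^+ k * u; have l0 : 0 < l by rewrite mulr_gt0 ?exprn_gt0.
rewrite !mulrDr; apply: lerD.
  apply: ler_pM; rewrite ?powR_ge0 //; apply: ge0_ler_powR;
    rewrite ?nnegrE ?divr_ge0 ?(ltW ch) ?(ltW h0) ?(ltW l0) //.
    by rewrite ler_piMl ?(ltW h0) ?(ltW c1).
  by rewrite ler_pM2r ?invr_gt0 // ler_piMl ?(ltW h0) ?(ltW c1).
have -> : (c * h) `^ b * (u / (c * h)) `^ q = c `^ (b - q) * (h `^ b * (u / h) `^ q).
  have -> : u / (c * h) = c^-1 * (u / h) by rewrite invfM mulrCA.
  rewrite [in LHS]powRM ?(ltW c0) ?(ltW h0) // [in LHS]powRM ?invr_ge0 ?divr_ge0 ?(ltW c0) ?(ltW h0) ?(ltW u0) //.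
  rewrite powR_inv ?(ltW c0) // powRB; last by rewrite (gt_eqF c0) implybT.
  by ring.
rewrite ler_piMl ?mulr_ge0 ?powR_ge0 //.
rewrite -[leRHS](powRr0 c); apply: ger_powR; last by rewrite subr_ge0.
by rewrite c0 ltW.
Qed.

End Step.

(** Each derivative lowers by one the degrees that must be killed: f with I is
    reduced to the partial derivatives with the weighted functionals, and, for
    shifts, with I itself. *)
Lemma estimates a m I rho B f : 0 < a -> a <= 1 -> bounded_functional I rho B ->
  kills (m + (a == 1)) I -> C_class m a f ->
  [/\ size_estimate I f (m%:R + a), shift_estimate I f (m%:R + a) (shift_rate a) &
      avg_estimate I f (m%:R + a) (avg_rate a) (shift_rate a)].
Proof.
move=> a0 a1; elim: m I B f => [|m IH] I B f bI kI Cf.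
  by rewrite add0r; exact: estimates_order0 bI kI Cf.
have b0 : 0 <= m%:R + a by rewrite addr_ge0 // ltW.
have p0 := ltW (avg_rate_gt0 a1).
have qa := shift_rate_le a; have q1 := le_trans qa a1.
have qb : shift_rate a <= m%:R + a by apply: (le_trans qa); rewrite lerDr.
have CF := C_class_C1 a0 Cf; have Cp i := C_class_partial i Cf.
have Ew i := IH _ _ _ (bounded_weighted bI i) (kills_weighted i kI) (Cp i).
have kI' : kills (m + (a == 1)) I by apply: killsW kI; rewrite addSn.
have E i := IH _ _ _ bI kI' (Cp i).
rewrite -nat1r -addrA; split.
- by apply: (size_step bI kI CF b0) => i; case: (Ew i).
- by apply: (shift_step bI CF b0 q1) => i; case: (E i).
- by apply: (avg_step bI kI CF b0 p0 qb) => i; case: (Ew i).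
Qed.

End Induction.

(** * A compactly supported charge is a compactly supported functional *)

Section ChargeFunctional.
Context {R : realType} {d : nat}.
Local Notation V := 'rV[R]_d.
Local Notation T := (borelRd R d).

Lemma borelRd_open (U : set V) : open U -> measurable (U : set T).
Proof. by move=> oU; exact: sub_sigma_algebra. Qed.

Lemma borelRd_continuous (f : V -> R) : continuous f -> measurable_fun [set: T] (f : T -> R).
Proof.
move=> cf; apply: (measurability _ (measurable_realfun.RGenOpens.measurableE R)).
move=> _ [_ [a [b ->] <-]]; rewrite setTI; apply: borelRd_open.
by move/continuousP : cf; apply; exact: interval_open.
Qed.

Lemma closed_out_norm (rho : R) : closed [set w : V | rho <= `|w|].
Proof.
rewrite (_ : [set w | _] = Num.norm @^-1` [set r | rho <= r]) //.
by apply: closed_comp; [move=> ? _; exact: norm_continuous|exact: closed_ge].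
Qed.

Section FiniteMeasure.
Variable mu : {measure set T -> \bar R}.
Hypothesis muT : (mu setT < +oo)%E.

(** The complement is a union of countably many compact annuli, each covered by
    finitely many null open sets. *)
Lemma null_outside_ball (rho : R) :
  (forall x : V, rho <= `|x| -> exists U : set V, [/\ open U, U x & mu U = 0%E]) ->
  mu (~` [set w : V | `|w| <= rho]) = 0%E.
Proof.
move=> nullU.
have mN (U : set V) : open U -> mu U = 0%E -> mu.-negligible (U : set T).
  by move=> oU U0; exists (U : set T); split => //; exact: borelRd_open.
apply: measure_negligible.
  apply: borelRd_open; apply: closed_openC; exact: closed_ball_norm.
have sub (X Y : set T) : X `<=` Y -> mu.-negligible Y -> mu.-negligible X.
  exact: negligibleS.
pose A (n : nat) := [set w : V | rho <= `|w|] `&` [set w : V | `|w| <= n%:R].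
apply: (@negligibleS _ _ _ _ (\bigcup_n (A n : set T))).
  move=> w /= /negP; rewrite -ltNge => rw.
  exists (Num.trunc `|w|).+1 => //; split => /=; first exact: ltW.
  by have /andP[_ /ltW] := truncn_itv (normr_ge0 w).
apply: negligible_bigcup => n.
have cA : compact (A n).
  rewrite /A setIC; apply: compact_closedI; first exact: compact_ball_norm.
  exact: closed_out_norm.
have [U HU] : {U : V -> set V & forall x, rho <= `|x| -> [/\ open (U x), U x x & mu (U x) = 0%E]}.
  apply: (@choice _ _ (fun x U => rho <= `|x| -> [/\ open U, U x & mu U = 0%E])) => x.
  case: (boolP (rho <= `|x|)) => [/nullU[U ?]|_]; first by exists U.
  by exists set0.
move: cA; rewrite compact_cover => /(_ V (A n) U).
have oU x : A n x -> open (U x) by case=> rx _; case: (HU x rx).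
have AU : A n `<=` cover (A n) U.
  by move=> x Ax; exists x => //; case: (HU x Ax.1).
move=> /(_ oU AU)[D DA AD].
apply: (sub _ _ AD).
rewrite /cover bigcup_fset big_seq.
elim/big_ind: _ => [|X Y nX nY|x].
- exact: negligible_set0.
- exact: negligibleU.
move=> /DA; rewrite inE => -[rx _]; case: (HU x rx) => oUx _ Ux0.
exact: mN.
Qed.

Section Supported.
Variable rho : R.
Hypothesis mu_out : mu (~` [set w : V | `|w| <= rho]) = 0%E.

Lemma supported_integral_bound (f : V -> R) (c : R) : 0 <= c -> continuous f ->
  (forall w, `|w| <= rho -> `|f w| <= c) ->
  (\int[mu]_(w in setT) `|(f w)%:E| <= c%:E * mu setT)%E.
Proof.
move=> c0 cf fc; apply: integral_le_bound => //.
  by apply/measurable_realfun.measurable_EFinP; exact: borelRd_continuous.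
exists (~` [set w : V | `|w| <= rho]); split=> //.
  by apply: borelRd_open; apply: closed_openC; exact: closed_ball_norm.
by move=> w /= H wr; apply: H => _; rewrite lee_fin; exact: fc.
Qed.

Lemma continuous_bounded_on_ball (f : V -> R) : continuous f ->
  exists2 c, 0 <= c & forall w, `|w| <= rho -> `|f w| <= c.
Proof.
move=> cf; have : compact (f @` [set w : V | `|w| <= rho]).
  apply: continuous_compact; last exact: compact_ball_norm.
  exact: continuous_subspaceT.
move=> /compact_bounded[M [_ HM]]; exists (Num.max 0 (M + 1)); first by rewrite le_max lexx.
move=> w wr; rewrite le_max; apply/orP; right.
by apply: (HM (M + 1)); [rewrite ltrDl|exists w].
Qed.

Lemma supported_integrable (f : V -> R) : continuous f ->
  mu.-integrable setT (EFin \o (f : T -> R)).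
Proof.
move=> cf; have [c c0 fc] := continuous_bounded_on_ball cf.
apply/integrableP; split; first by apply/measurable_realfun.measurable_EFinP; exact: borelRd_continuous.
apply: (le_lt_trans (supported_integral_bound c0 cf fc)).
have : mu setT \is a fin_num by rewrite ge0_fin_numE.
by move=> /fineK <-; rewrite -EFinM ltry.
Qed.

Lemma supported_Rintegral_bound (f : V -> R) (c : R) : continuous f ->
  (forall w, `|w| <= rho -> `|f w| <= c) -> 0 <= c ->
  `|\int[mu]_(w in setT) (f : T -> R) w| <= fine (mu setT) * c.
Proof.
move=> cf fc c0; have If := supported_integrable cf.
apply: (le_trans (le_normr_Rintegral _ If)) => //.
have fT : mu setT \is a fin_num by rewrite ge0_fin_numE.
have E : (fine (mu setT) * c)%:E = (c%:E * mu setT)%E by rewrite EFinM fineK // muleC.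
rewrite -lee_fin E /Rintegral fineK.
  exact: supported_integral_bound.
have /integrableP[_] := If; rewrite ge0_fin_numE //.
by apply: integral_ge0 => w _; rewrite lee_fin.
Qed.

End Supported.
End FiniteMeasure.

Section Charge.
Variable sigma : {charge set T -> \bar R}.

Lemma charge_bounded_functional : compactly_supported sigma ->
  exists rho B, bounded_functional (charge_Rintegral sigma) rho B.
Proof.
move=> cS.
have [rho rho0 Hrho] : exists2 rho, 0 < rho & forall x, charge_support sigma x -> `|x| < rho.
  have /compact_bounded[M [_ HM]] := cS; exists (Num.max 1 (M + 1 + 1)).
    by rewrite lt_max ltr01.
  move=> x Sx; rewrite lt_max; apply/orP; right.
  by apply: (@le_lt_trans _ _ (M + 1)); [apply: HM; rewrite ?ltrDl|rewrite ltrDl].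
pose P := jordan_pos (hahn_pos_negP sigma); pose N := jordan_neg (hahn_pos_negP sigma).
have nullPN x : rho <= `|x| -> exists U : set V, [/\ open U, U x, P U = 0%E & N U = 0%E].
  move=> rx; have /existsNP[U /not_implyP[oU /not_implyP[Ux /negP]]] : ~ charge_support sigma x.
    by move=> /Hrho; rewrite ltNge rx.
  rewrite -leNgt => U0; exists U; split=> //; apply/eqP; rewrite eq_le measure_ge0 andbT;
    apply: le_trans U0; rewrite /total_variation /charge_variation /=.
    by rewrite leeDl ?measure_ge0.
  by rewrite leeDr ?measure_ge0.
have P0 : P (~` [set w : V | `|w| <= rho]) = 0%E.
  by apply: null_outside_ball => x /nullPN[U [? ? ? ?]]; exists U.
have N0 : N (~` [set w : V | `|w| <= rho]) = 0%E.
  by apply: null_outside_ball => x /nullPN[U [? ? ? ?]]; exists U.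
have PT : (P setT < +oo)%E by rewrite -ge0_fin_numE ?fin_num_measure.
have NT : (N setT < +oo)%E by rewrite -ge0_fin_numE ?fin_num_measure.
exists rho, (fine (P setT) + fine (N setT)); split=> //.
- by rewrite addr_ge0 // fine_ge0.
- move=> f g cf cg; rewrite /charge_Rintegral.
  rewrite !RintegralD //; try exact: (supported_integrable PT P0);
    try exact: (supported_integrable NT N0).
  by rewrite opprD addrACA.
- move=> c f cf; rewrite /charge_Rintegral mulrBr.
  by rewrite !RintegralZl //; [exact: (supported_integrable NT N0)|exact: (supported_integrable PT P0)].
- move=> f c cf fc; rewrite mulrDl.
  have c0 : 0 <= c by apply: le_trans (fc 0 _); rewrite ?normr0 // ltW.
  apply: (le_trans (ler_normB _ _)); apply: lerD.
    exact: (supported_Rintegral_bound PT P0).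
  exact: (supported_Rintegral_bound NT N0).
Qed.

End Charge.
End ChargeFunctional.

(** * Integrals of powers, and means of integrals *)

Section PowerIntegrals.
Context {R : realType}.
Implicit Types (a c e h K : R) (g : R -> R).
Local Notation leb := (@lebesgue_measure R).

Lemma within_pos a c g : 0 < a -> (forall h, 0 < h -> {for h, continuous g}) ->
  {within `[a, c], continuous g}.
Proof.
move=> a0 cg; apply: continuous_in_subspaceT => h; rewrite inE /= in_itv /= => /andP[ah _].
by apply: cg; exact: lt_le_trans ah.
Qed.

Lemma integrable_pos a c g : 0 < a -> (forall h, 0 < h -> {for h, continuous g}) ->
  leb.-integrable `[a, c] (EFin \o g).
Proof.
move=> a0 cg; apply: continuous_compact_integrable; first exact: segment_compact.
exact: within_pos.
Qed.

Lemma Rintegral_split a c e g : 0 < a -> a <= c -> c <= e ->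
  (forall h, 0 < h -> {for h, continuous g}) ->
  \int[leb]_(h in `[a, e]) g h = \int[leb]_(h in `[a, c]) g h + \int[leb]_(h in `[c, e]) g h.
Proof.
move=> a0 ac ce cg.
have Ig := integrable_pos e a0 cg.
have := Rintegral_itvB Ig (x := c); rewrite !bnd_simp => /(_ ac ce) E.
rewrite -(@Rintegral_itv_obnd_cbnd _ c (BRight e) g); last first.
  apply: integrableS Ig => //.
  by apply: subset_itvr; rewrite bnd_simp.
by rewrite -E addrC subrK.
Qed.

Lemma continuous_powR e h : 0 < h -> {for h, continuous (fun t : R => t `^ e)}.
Proof.
move=> h0; apply: differentiable_continuous; apply/derivable1_diffP.
by apply: derivable_powR; rewrite in_itv /= h0.
Qed.

Lemma Rintegral_powR a c e : 0 < a -> a <= c -> e != 0 ->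
  \int[leb]_(h in `[a, c]) h `^ (e - 1) = (c `^ e - a `^ e) / e.
Proof.
move=> a0; rewrite le_eqVlt => /orP[/eqP <- _|ac e0].
  by rewrite subrr mul0r set_itv1 Rintegral_set1.
pose F (h : R) : R := e^-1 * h `^ e.
have dF h : 0 < h -> derivable F h 1.
  by move=> h0; apply: derivableM => //; apply: derivable_powR; rewrite in_itv /= h0.
have cF h : 0 < h -> {for h, continuous F}.
  by move=> h0; apply: differentiable_continuous; apply/derivable1_diffP; exact: dF.
have c0 := lt_trans a0 ac.
rewrite /Rintegral (@continuous_FTC2 _ _ F) //=.
- by rewrite /F -mulrBr mulrC.
- by apply: within_pos => // h; exact: continuous_powR.
- split => [h||].
  + by rewrite in_itv /= => /andP[ah _]; apply: dF; exact: lt_trans ah.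
  + by apply: cvg_at_right_filter; exact: cF.
  + by apply: cvg_at_left_filter; exact: cF.
move=> h; rewrite in_itv /= => /andP[ah _].
have h0 : 0 < h by exact: lt_trans ah.
have hI : h \in `]0, +oo[ by rewrite in_itv /= h0.
rewrite derive1E deriveM //; last exact: derivable_powR.
rewrite derive_cst scaler0 addr0 -derive1E powR_derive1 //.
by rewrite [LHS]mulrA mulVf // mul1r.
Qed.

Lemma Rintegral_powR_bound a c g K1 K2 e1 e2 : 0 < a -> a <= c -> e1 != 0 -> e2 != 0 ->
  (forall h, 0 < h -> {for h, continuous g}) ->
  (forall h, a <= h <= c -> `|g h| <= K1 * h `^ (e1 - 1) + K2 * h `^ (e2 - 1)) ->
  `|\int[leb]_(h in `[a, c]) g h| <=
  K1 * ((c `^ e1 - a `^ e1) / e1) + K2 * ((c `^ e2 - a `^ e2) / e2).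
Proof.
move=> a0 ac e10 e20 cg gK.
have Ig := integrable_pos c a0 cg.
have cp e h : 0 < h -> {for h, continuous (fun t : R => t `^ e)}.
  exact: continuous_powR.
have cKp K e h : 0 < h -> {for h, continuous (fun t : R => K * t `^ e)}.
  by move=> h0; apply: continuousM; [exact: cst_continuous|exact: cp].
have Ip e := integrable_pos c a0 (cp e).
have IKp K e := integrable_pos c a0 (cKp K e).
rewrite -!Rintegral_powR // -!RintegralZl // -RintegralD //.
apply: (le_trans (le_normr_Rintegral _ Ig)) => //.
apply: le_Rintegral => //.
- apply: (integrable_pos c a0) => h h0.
  by apply: (@continuous_comp _ _ _ g Num.norm); [exact: cg|exact: norm_continuous].
- apply: (integrable_pos c a0) => h h0.
  by apply: (@continuousD _ _ _ (fun h => K1 * h `^ (e1 - 1)) (fun h => K2 * h `^ (e2 - 1))); exact: cKp.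
Qed.

End PowerIntegrals.

Lemma continuous_sum_for {R : realType} (J : Type) (r : seq J) (F : J -> R -> R) (h : R) :
  (forall j, {for h, continuous (F j)}) -> {for h, continuous (fun t => \sum_(j <- r) F j t)}.
Proof.
move=> cF; change (continuous_at h (fun t => \sum_(j <- r) F j t)).
elim: r => [|j r IH].
  by under eq_fun do rewrite big_nil; exact: cst_continuous.
under eq_fun do rewrite big_cons.
by apply: (@continuousD _ _ _ (F j) (fun t => \sum_(i <- r) F i t)) => //; exact: cF.
Qed.

Section CubeIntegral.
Context {R : realType} {d : nat}.
Local Notation V := 'rV[R]_d.
Local Notation leb := (@lebesgue_measure R).

Lemma Rintegral_cmean (a c : R) (G : {ffun 'I_d -> bool} -> R -> R) : 0 < a ->
  (forall e h, 0 < h -> {for h, continuous (G e)}) ->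
  \int[leb]_(h in `[a, c]) cmean (G ^~ h) = cmean (fun e => \int[leb]_(h in `[a, c]) G e h).
Proof.
move=> a0 cG.
have cS (r : seq {ffun 'I_d -> bool}) h : 0 < h ->
    {for h, continuous (fun h : R => \sum_(e <- r) G e h)}.
  by move=> h0; apply: continuous_sum_for => e; exact: cG.
rewrite /cmean RintegralZl //; last by apply: integrable_pos => // h; exact: cS.
congr (_ * _); elim: (index_enum _) => [|e r IH].
  rewrite big_nil; under eq_Rintegral do rewrite big_nil.
  by rewrite /Rintegral integral0.
rewrite big_cons -IH; under eq_Rintegral do rewrite big_cons.
by rewrite RintegralD //; apply: integrable_pos => // h; [exact: cG|exact: cS].
Qed.

Lemma continuous_cubeavg_param (g : V -> R -> R) u k h :
  (forall x, {for h, continuous (g x)}) ->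
  forall x, {for h, continuous (fun t => cubeavg u k (g ^~ t) x)}.
Proof.
move=> cg; elim: k => [//|k IH] x /=.
rewrite /cmean; apply: continuousM; first exact: cst_continuous.
by apply: continuous_sum_for => e; exact: IH.
Qed.

Lemma Rintegral_cubeavg (g : V -> R -> R) u k (a c : R) x : 0 < a ->
  (forall x h, 0 < h -> {for h, continuous (g x)}) ->
  cubeavg u k (fun y => \int[leb]_(h in `[a, c]) g y h) x =
  \int[leb]_(h in `[a, c]) cubeavg u k (g ^~ h) x.
Proof.
move=> a0 cg; elim: k x => [//|k IH] x /=.
rewrite (@Rintegral_cmean a c (fun e h => cubeavg u k (g ^~ h) (x + (2 ^+ k * u) *: bits e))) //.
  by apply: eq_cmean => e; exact: IH.
by move=> e h h0; apply: continuous_cubeavg_param => y; exact: cg.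
Qed.

End CubeIntegral.

(** * The truncated integrals form an approximate martingale on dyadic cubes *)

Section Truncations.
Context {R : realType} {d : nat}.
Local Notation V := 'rV[R]_d.
Local Notation leb := (@lebesgue_measure R).
Implicit Types (x y : V).

(** The scale l is a reversed time, at which U l is determined up to K on balls of
    radius l. The first condition is the martingale property up to K, over any
    number of generations at once: a condition on one generation would let the
    errors accumulate. *)
Definition approximate_martingale (U : R -> V -> R) (K : R) : Prop :=
  [/\ forall x u k, 0 < u -> 2 ^+ k * u <= 1 ->
        `|cubeavg u k (U u) x - U (2 ^+ k * u) x| <= K,
      forall x y l, 0 < l -> l <= 1 -> `|y| <= l -> `|U l (x + y) - U l x| <= K &
      forall x a c, 0 < a -> a <= c -> c <= 2 * a -> c <= 1 -> `|U a x - U c x| <= K].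

Variables (I : (V -> R) -> R) (rho B : R) (f : V -> R) (b p q : R).
Hypotheses (bI : bounded_functional I rho B) (cf : continuous f).
Hypotheses (p0 : 0 < p) (q0 : 0 < q).

Lemma continuous_dil x : continuous (dil I f x).
Proof.
have cH : continuous (fun z : R * V => f (x + z.1 *: z.2)).
  move=> z; apply: (@continuous_comp _ _ _ (fun z : R * V => x + z.1 *: z.2) f); last exact: cf.
  apply: (@continuousD _ _ _ (fun=> x) (fun z : R * V => z.1 *: z.2)).
    exact: cst_continuous.
  by apply: continuousZ; [exact: cvg_fst|exact: cvg_snd].
move=> t; apply/cvgrPdist_le => e e0.
have B1 : 0 < B + 1 by have := bf_B bI; lra.
have e1 : 0 < e / (B + 1) by rewrite divr_gt0.
near=> s.
rewrite -normrN opprB /dil -(bfB bI); [|exact: continuous_dil_arg..].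
apply: (@le_trans _ _ (B * (e / (B + 1)))); last first.
  rewrite mulrA ler_pdivrMr // mulrC; apply: ler_pM => //; [exact: ltW|exact: bf_B bI|lra].
apply: (bf_bound bI); first by apply: continuousBf; exact: continuous_dil_arg.
near: s; exact: (uniform_near_compact rho t e1 cH).
Unshelve. all: by end_near. Qed.

Definition trunc_integrand x h : R := dil I f x h / h `^ b / h.
Definition trunc_integral a c x : R := \int[leb]_(h in `[a, c]) trunc_integrand x h.

Lemma continuous_trunc_integrand x h : 0 < h -> {for h, continuous (trunc_integrand x)}.
Proof.
move=> h0; apply: (@continuousM _ _ (fun h => dil I f x h / h `^ b) (fun h => h^-1)).
  apply: (@continuousM _ _ (dil I f x) (fun h => (h `^ b)^-1)); first exact: continuous_dil.
  apply: (@continuous_comp _ _ _ (fun h : R => h `^ b) (fun r : R => r^-1)).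
    exact: continuous_powR.
  by apply: inv_continuous; rewrite gt_eqF // powR_gt0.
by apply: inv_continuous; rewrite gt_eqF.
Qed.

Lemma trunc_integral_split a c e x : 0 < a -> a <= c -> c <= e ->
  trunc_integral a e x = trunc_integral a c x + trunc_integral c e x.
Proof.
by move=> a0 ac ce; apply: Rintegral_split => // h; exact: continuous_trunc_integrand.
Qed.

Lemma norm_div_weight (s t h : R) : 0 < h -> `|s| <= t * h `^ b -> `|s / h `^ b / h| <= t / h.
Proof.
move=> h0 st; rewrite normrM normrV ?unitfE ?gt_eqF // (gtr0_norm h0).
rewrite ler_wpM2r ?invr_ge0 ?(ltW h0) // normrM normrV ?unitfE ?gt_eqF ?powR_gt0 //.
by rewrite (gtr0_norm (powR_gt0 _ h0)) ler_pdivrMr ?powR_gt0.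
Qed.

Lemma short_trunc_integral : size_estimate I f b -> exists2 K, 0 <= K &
  forall x a c, 0 < a -> a <= c -> c <= 2 * a -> `|trunc_integral a c x| <= K.
Proof.
move=> [C C0 HC]; exists C => // x a c a0 ac c2a.
apply: (le_trans (@Rintegral_powR_bound _ a c _ (C / a) 0 1 1 a0 ac (oner_neq0 _) (oner_neq0 _) _ _)).
- by move=> h; exact: continuous_trunc_integrand.
- move=> h /andP[ah hc]; have h0 := lt_le_trans a0 ah.
  rewrite subrr powRr0 mulr1 mul0r addr0.
  apply: (le_trans (norm_div_weight h0 (HC x h h0))).
  by rewrite ler_wpM2l // lef_pV2.
rewrite mul0r addr0 divr1 !powRr1 ?(ltW a0) ?(le_trans (ltW a0)) // mulrAC ler_pdivrMr //.
by rewrite ler_wpM2l //; lra.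
Qed.

(** The gain (|y| / h)^q integrates against dh/h to a constant above the scale |y|. *)
Lemma trunc_integral_shift : shift_estimate I f b q -> exists2 K, 0 <= K &
  forall x y l, 0 < l -> l <= 1 -> `|y| <= l ->
    `|trunc_integral l 1 (x + y) - trunc_integral l 1 x| <= K.
Proof.
move=> [C C0 HC]; exists (C / q); first by rewrite divr_ge0 // ltW.
move=> x y l l0 l1 yl.
have ci z := integrable_pos 1 l0 (@continuous_trunc_integrand z).
rewrite /trunc_integral -RintegralB //.
have nq : - q != 0 by rewrite oppr_eq0 gt_eqF.
apply: (le_trans (@Rintegral_powR_bound _ l 1 _ (C * l `^ q) 0 (- q) (- q) l0 l1 nq nq _ _)).
- move=> h h0; apply: (@continuousB _ _ _ (trunc_integrand (x + y)) (trunc_integrand x));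
    exact: continuous_trunc_integrand.
- move=> h /andP[lh _]; have h0 := lt_le_trans l0 lh.
  rewrite mul0r addr0 -mulrBl -mulrBl.
  have yh := le_trans yl lh.
  have H : `|dil I f (x + y) h - dil I f x h| <= C * (`|y| / h) `^ q * h `^ b.
    by rewrite mulrAC -mulrA; exact: HC.
  apply: (le_trans (norm_div_weight h0 H)).
  rewrite -!mulrA ler_wpM2l // powRB; last by rewrite (gt_eqF h0) implybT.
  rewrite powRr1 ?(ltW h0) // powRN mulrA ler_wpM2r ?invr_ge0 ?(ltW h0) //.
  rewrite powRM ?invr_ge0 ?(ltW h0) // powR_inv ?(ltW h0) // ler_wpM2r ?invr_ge0 ?powR_ge0 //.
  by apply: ge0_ler_powR; rewrite ?nnegrE ?(ltW q0) ?(ltW l0).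
rewrite mul0r addr0 powR1 -mulrA ler_wpM2l // powRN invrN mulrN -mulNr opprB mulrA.
rewrite -[leRHS]mul1r ler_wpM2r ?invr_ge0 ?(ltW q0) // mulrBr mulfV ?gt_eqF ?powR_gt0 //.
by rewrite mulr1 lerBlDr lerDl powR_ge0.
Qed.

(** This is the cancellation that no bound on the size of the dilates can give:
    the scales between the mesh u and the side of the cube, of which there are
    arbitrarily many, contribute a bounded amount to the mean. *)
Lemma trunc_integral_avg : avg_estimate I f b p q -> exists2 K, 0 <= K &
  forall x u k, 0 < u ->
    `|cubeavg u k (trunc_integral u (2 ^+ k * u)) x| <= K.
Proof.
move=> [C C0 HC]; exists (C / p + C / q).
  by rewrite addr_ge0 // divr_ge0 // ltW.
move=> x u k u0; rewrite /trunc_integral; set l := 2 ^+ k * u.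
have l0 : 0 < l by rewrite mulr_gt0 ?exprn_gt0.
have ul : u <= l by rewrite -[leLHS]mul1r ler_wpM2r ?(ltW u0) // exprn_ege1 // ler1n.
rewrite (Rintegral_cubeavg u k l x u0 (@continuous_trunc_integrand)).
have nq : - q != 0 by rewrite oppr_eq0 gt_eqF.
have np : p != 0 by rewrite gt_eqF.
apply: (le_trans (@Rintegral_powR_bound _ u l _ (C * l `^ (- p)) (C * u `^ q) p (- q) u0 ul np nq _ _)).
- move=> h h0; apply: continuous_cubeavg_param => y; exact: continuous_trunc_integrand.
- move=> h /andP[uh hl]; have h0 := lt_le_trans u0 uh.
  have -> : cubeavg u k (fun y => trunc_integrand y h) x = dil I (cubeavg u k f) x h / h `^ b / h.
    rewrite (dil_cubeavg bI) // -mulrA mulrC -cubeavgZ; apply: eq_cubeavg => y.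
    by rewrite /trunc_integrand -mulrA mulrC.
  have H : `|dil I (cubeavg u k f) x h| <= C * ((h / l) `^ p + (u / h) `^ q) * h `^ b.
    by rewrite mulrAC -mulrA; exact: HC.
  apply: (le_trans (norm_div_weight h0 H)).
  clearbody l; rewrite !powRB ?(gt_eqF h0) ?implybT // !powRr1 ?(ltW h0) // !powRN.
  rewrite !powRM ?invr_ge0 ?(ltW h0) ?(ltW l0) ?(ltW u0) // !powR_inv ?(ltW h0) ?(ltW l0) //.
  rewrite le_eqVlt; apply/orP; left; apply/eqP.
  by field; rewrite !gt_eqF ?powR_gt0.
have lp : 0 < l `^ p by rewrite powR_gt0.
have up : 0 < u `^ p by rewrite powR_gt0.
have lq : 0 < l `^ q by rewrite powR_gt0.
have uq : 0 < u `^ q by rewrite powR_gt0.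
rewrite !powRN; apply: lerD.
  rewrite -!mulrA ler_wpM2l // mulrA -[leRHS]mul1r ler_wpM2r ?invr_ge0 ?(ltW p0) //.
  by rewrite mulrBr mulVf ?gt_eqF // lerBlDr lerDl mulr_ge0 ?invr_ge0 ?powR_ge0.
rewrite -!mulrA ler_wpM2l // invrN mulrN -mulNr opprB mulrA -[leRHS]mul1r.
rewrite ler_wpM2r ?invr_ge0 ?(ltW q0) // mulrBr mulfV ?gt_eqF // lerBlDr lerDl.
by rewrite mulr_ge0 ?invr_ge0 ?powR_ge0.
Qed.

Lemma trunc_integral_approximate_martingale :
  size_estimate I f b -> shift_estimate I f b q -> avg_estimate I f b p q ->
  exists2 K, 0 <= K & approximate_martingale (fun eps => trunc_integral eps 1) K.
Proof.
move=> /short_trunc_integral[K1 K10 H1] /trunc_integral_shift[K2 K20 H2].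
move=> /trunc_integral_avg[K3 K30 H3]; exists (K1 + K2 + K3); first by rewrite !addr_ge0.
split=> [x u k u0 l1|x y l l0 l1 yl|x a c a0 ac c2a c1].
- set l := 2 ^+ k * u in l1 *.
  have l0 : 0 < l by rewrite mulr_gt0 ?exprn_gt0.
  have ul : u <= l by rewrite -[leLHS]mul1r ler_wpM2r ?(ltW u0) // exprn_ege1 // ler1n.
  rewrite (eq_cubeavg u k (g := fun y => trunc_integral u l y + trunc_integral l 1 y)); last first.
    by move=> y; exact: trunc_integral_split.
  rewrite cubeavgD -[X in _ - X](cubeavg_const u k (trunc_integral l 1 x) x) -addrA -cubeavgB.
  apply: (le_trans (ler_normD _ _)).
  have := H3 x u k u0; rewrite -/l.
  have : `|cubeavg u k (fun y => trunc_integral l 1 y - trunc_integral l 1 x) x| <= K2.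
    by apply: cubeavg_bound => [|y yl]; [exact: ltW|exact: H2].
  lra.
- by have := H2 x y l l0 l1 yl; lra.
- rewrite (trunc_integral_split x a0 ac c1) addrK.
  by have := H1 x a c a0 ac c2a; lra.
Qed.

End Truncations.

Lemma fmap_ultra {S T : Type} (g : S -> T) (F : set_system S) :
  UltraFilter F -> UltraFilter (g @ F).
Proof.
move=> uF; have pF := @ultra_proper _ _ uF.
split; first exact: fmap_proper_filter.
move=> G pG FG; apply/seteqP; split=> // A GA.
have [//|FA] := in_ultra_setVsetC (g @^-1` A) uF.
have GA' : G (~` A) by exact: FG.
have : G set0 by rewrite -(setICr A); exact: (@filterI _ _ (@filter_filter _ _ pG)).
by move=> /(@filter_not_empty _ _ pG).
Qed.

Section LimitMartingale.
Context {R : realType} {d : nat}.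
Local Notation V := 'rV[R]_d.
Implicit Types (x y a : V) (n : nat).

Definition child n a e : V := a + (2 ^- n.+1 : R) *: bits e.

Variables (U : R -> V -> R) (K : R).
Hypothesis UK : approximate_martingale U K.

Lemma pow2_shift n N : (n <= N)%N -> 2 ^+ (N - n) * 2 ^- N = 2 ^- n :> R.
Proof.
move=> nN; have N0 k : (2 : R) ^+ k != 0 by rewrite expf_neq0 // pnatr_eq0.
by rewrite -{2}(subnK nN) exprD invfM mulVKf.
Qed.

Lemma pow2V_gt0 n : 0 < 2 ^- n :> R.
Proof. by rewrite invr_gt0 exprn_gt0. Qed.

Lemma pow2V_le1 n : 2 ^- n <= 1 :> R.
Proof. by rewrite invf_le1 ?exprn_gt0 // exprn_ege1 // ler1n. Qed.

Lemma pow2VS n : 2 ^- n = 2 * 2 ^- n.+1 :> R.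
Proof. by rewrite exprS invfM mulVKf. Qed.

(** For a fixed mesh 2^-N the averages are exactly additive over subcubes, but
    only down to generation N. An ultrafilter provides a limit as N grows for all
    cubes at once, additive and still within K of U, so that the question whether
    the averages converge does not arise. *)
Lemma limit_martingale : exists M : nat -> V -> R,
  (forall n a, M n a = cmean (fun e => M n.+1 (child n a e))) /\
  (forall n a, `|M n a - U (2 ^- n) a| <= K).
Proof.
have [UA _ _] := UK.
pose s n a N := cubeavg (2 ^- N) (N - n) (U (2 ^- N)) a.
have sU n a N : (n <= N)%N -> `|s n a N - U (2 ^- n) a| <= K.
  move=> nN; have := UA a (2 ^- N) (N - n)%N (pow2V_gt0 N).
  by rewrite pow2_shift // => /(_ (pow2V_le1 n)).
have [F [uF ooF]] := ultraFilterLemma (eventually_filter).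
have pF := @ultra_proper _ _ uF.
have lim n a : {l | s n a @ F --> l & `|l - U (2 ^- n) a| <= K}.
  apply: cid2.
  have := @segment_compact R (U (2 ^- n) a - K) (U (2 ^- n) a + K).
  rewrite compact_ultra => /(_ (s n a @ F) (fmap_ultra _ uF))[].
    apply: ooF; exists n => // N /= nN.
    by rewrite in_itv /=; have := sU n a N nN; rewrite ler_distl.
  move=> l [/= lK sl]; exists l => //.
  by rewrite ler_distl; move: lK; rewrite in_itv.
exists (fun n a => s2val (lim n a)); split=> n a; last by case: (lim n a).
have cn := s2valP (lim n a).
have cS : cmean (fun e => s n.+1 (child n a e) N) @[N --> F] -->
    cmean (fun e => s2val (lim n.+1 (child n a e))).
  rewrite /cmean; apply: cvgM; first exact: cvg_cst.
  elim: (index_enum _) => [|e r IH].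
    by rewrite big_nil; under eq_fun do rewrite big_nil; exact: cvg_cst.
  rewrite big_cons; under eq_fun do rewrite big_cons.
  by apply: cvgD IH; exact: s2valP (lim n.+1 (child n a e)).
apply: (@cvg_unique R (@Rhausdorff R) (s n a @ F)) => //.
apply: cvg_trans cS; apply: near_eq_cvg; apply: ooF; exists n.+1 => // N /= nN.
rewrite /s -(subnSK nN) /=; apply: eq_cmean => e.
by rewrite pow2_shift.
Qed.

Section Consequences.
Variable M : nat -> V -> R.
Hypothesis MU : forall n a, `|M n a - U (2 ^- n) a| <= K.

Lemma martingale_increment n a e : `|M n.+1 (child n a e) - M n a| <= 4 * K.
Proof.
have [_ UB UC] := UK.
have h1 := MU n.+1 (child n a e); have h2 := MU n a.
have h3 : `|U (2 ^- n.+1) (child n a e) - U (2 ^- n.+1) a| <= K.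
  apply: UB; [exact: pow2V_gt0|exact: pow2V_le1|].
  by rewrite normrZ (gtr0_norm (pow2V_gt0 _)) ler_piMr ?norm_bits // ltW ?pow2V_gt0.
have h4 : `|U (2 ^- n.+1) a - U (2 ^- n) a| <= K.
  apply: UC; [exact: pow2V_gt0| |by rewrite -pow2VS|exact: pow2V_le1].
  by rewrite (pow2VS n) ler_peMl ?ler1n // ltW ?pow2V_gt0.
move: h1 h2 h3 h4; rewrite !ler_norml => /andP[? ?] /andP[? ?] /andP[? ?] /andP[? ?].
by apply/andP; split; lra.
Qed.

Lemma martingale_controls n a x eps : `|x - a| <= 2 ^- n ->
  2 ^- n.+1 <= eps <= 2 ^- n -> `|U eps x - M n a| <= 3 * K.
Proof.
move=> xa /andP[e1 e2]; have [_ UB UC] := UK.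
have h1 := MU n a.
have h2 := UB a (x - a) _ (pow2V_gt0 n) (pow2V_le1 n) xa; rewrite subrKC in h2.
have e0 : 0 < eps by apply: lt_le_trans e1; exact: pow2V_gt0.
have h3 := UC x eps (2 ^- n) e0 e2.
have h4 : 2 ^- n <= 2 * eps by rewrite pow2VS ler_wpM2l.
have := h3 h4 (pow2V_le1 n).
move: h1 h2; rewrite !ler_norml => /andP[? ?] /andP[? ?] /andP[? ?].
by apply/andP; split; lra.
Qed.

End Consequences.
End LimitMartingale.

(** * Covers of the surviving dyadic paths *)

Section DyadicTree.
Context {R : realType} {d : nat}.
Local Notation V := 'rV[R]_d.
Implicit Types (x y a : V) (n : nat).

Definition cube n a : set V := [set x | forall i, a ord0 i <= x ord0 i <= a ord0 i + 2 ^- n].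

Definition dyadic_path (a : nat -> V) : Prop :=
  a 0%N = 0 /\ forall n, exists e, a n.+1 = child n (a n) e.

(** Corners increase and opposite corners decrease along a path. *)
Lemma dyadic_path_cube (a : nat -> V) : dyadic_path a ->
  exists x, forall n, cube n (a n) x.
Proof.
move=> [_ aS].
have coordS n i : exists e : bool, a n.+1 ord0 i = a n ord0 i + 2 ^- n.+1 * e%:R.
  by have [e ->] := aS n; exists (e i); rewrite !mxE.
have mono i : nondecreasing_seq (fun n => a n ord0 i).
  apply/nondecreasing_seqP => n.
  by have [e ->] := coordS n i; rewrite lerDl mulr_ge0 // invr_ge0 exprn_ge0.
have anti i : nonincreasing_seq (fun n => a n ord0 i + 2 ^- n).
  apply/nonincreasing_seqP => n; have [e ->] := coordS n i; rewrite (pow2VS n) -addrA lerD2l.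
  have := pow2V_gt0 (R := R) n.+1; case: e => /=; lra.
have upper i n m : a m ord0 i <= a n ord0 i + 2 ^- n.
  have P k := pow2V_gt0 (R := R) k.
  have [nm|/ltnW mn] := leqP n m.
    by apply: le_trans (anti i _ _ nm); rewrite lerDl ltW.
  by apply: le_trans (mono i _ _ mn) _; rewrite lerDl ltW.
exists (\row_i sup (range (fun n => a n ord0 i))) => n i; rewrite mxE; apply/andP; split.
  apply: ub_le_sup; last by exists n.
  by exists (a 0%N ord0 i + 2 ^- 0) => _ [m _ <-]; exact: upper.
apply: ge_sup; first by exists (a 0%N ord0 i), 0%N.
by move=> _ [m _ <-]; exact: upper.
Qed.

Section Costs.
Variable w : nat -> V -> R.
Hypothesis w_ge0 : forall n a, 0 <= w n a.

Fixpoint cost (X : set V) k n a : R :=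
  if k is k'.+1 then \sum_e cost X k' n.+1 (child n a e)
  else if `[< cube n a `&` X !=set0 >] then w n a else 0.

Lemma cost_ge0 X k n a : 0 <= cost X k n a.
Proof.
elim: k n a => [|k IH] n a /=; first by case: ifP.
by apply: sumr_ge0.
Qed.

Lemma cost_empty k n a : cost set0 k n a = 0.
Proof.
elim: k n a => [|k IH] n a /=; last by apply: big1 => e _; exact: IH.
by rewrite setI0; case: asboolP => // -[].
Qed.

(** Increments of clamp over unit steps are 1 on [0, 3] and nonnegative elsewhere,
    so that the increment over 2^k units bounds the number of points of a unit
    grid that lie in an interval of length 3, without counting them. *)
Definition clamp (r : R) : R := Num.min (Num.max r 0) 4.

Lemma clamp_mono r t : r <= t -> clamp r <= clamp t.
Proof.
move=> rt; rewrite /clamp; case: (leP r 0) => r0; case: (leP t 0) => t0;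
  rewrite ?ge_min ?le_min ?lexx ?rt ?(ltW t0) ?orbT ?andbT //=; lra.
Qed.

Lemma clamp_unit r : 0 <= r <= 3 -> clamp (r + 1) - clamp r = 1.
Proof.
move=> /andP[r0 r3]; rewrite /clamp.
by rewrite !max_l ?min_l; lra.
Qed.

Lemma clamp_bound r t : clamp t - clamp r <= 4.
Proof.
have : clamp t <= 4 by rewrite /clamp ge_min lexx orbT.
have : 0 <= clamp r by rewrite /clamp le_min le_max lexx orbT ler0n.
lra.
Qed.

(** At most 4^d cubes of a generation meet a set no wider than their side. The
    bound passes from a cube to its halves because the increments of clamp add up
    in each coordinate, and products over coordinates expand into sums over the
    2^d halves. *)
Lemma cost_bound X k n a W : 0 <= W -> (forall b, w (n + k) b <= W) ->
  (forall x y, X x -> X y -> `|x - y| <= 2 ^- (n + k)) ->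
  cost X k n a <= 4 ^+ d * W.
Proof.
move=> W0 wW Xd.
have [->|/set0P[u Xu]] := eqVneq X set0; first by rewrite cost_empty mulr_ge0 ?exprn_ge0.
(* position of the cube in units of the final side, shifted so that cubes that
   meet X have positions in [0, 3] *)
pose s n k (a : V) i := (a ord0 i - u ord0 i) * 2 ^+ (n + k) + 2.
suff H : cost X k n a <= W * \prod_i (clamp (s n k a i + 2 ^+ k) - clamp (s n k a i)).
  have -> : 4 ^+ d = \prod_(i < d) 4 :> R by rewrite prodr_const card_ord.
  apply: (le_trans H); rewrite mulrC ler_wpM2r //.
  apply: ler_prod => i _; rewrite clamp_bound subr_ge0 clamp_mono // lerDl exprn_ge0 //.
elim: k n a wW Xd => [|k IH] n a wW Xd /=.
  have nn : 0 <= W * \prod_i (clamp (s n 0%N a i + 2 ^+ 0) - clamp (s n 0%N a i)).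
    rewrite mulr_ge0 // prodr_ge0 // => i _.
    by rewrite subr_ge0 clamp_mono // lerDl.
  case: asboolP => // -[z [az Xz]].
  rewrite big1 ?mulr1 => [|i _]; first by rewrite -(addn0 n); exact: wW.
  rewrite expr0; apply: clamp_unit; rewrite /s addn0.
  have /andP[z1 z2] := az i.
  have := Xd _ _ Xz Xu; rewrite addn0 => /(le_trans (ler_coord_norm _ i)).
  rewrite !mxE ler_norml => /andP[h1 h2].
  have P := pow2V_gt0 (R := R) n; have P2 : 2 ^- n * 2 ^+ n = 1 :> R by rewrite mulVf ?expf_neq0.
  have P3 : 0 < 2 ^+ n :> R by rewrite exprn_gt0.
  have : (a ord0 i - u ord0 i) <= 2 ^- n by lra.
  rewrite -(ler_pM2r P3) P2 => h3.
  have : - (2 * 2 ^- n) <= (a ord0 i - u ord0 i) by lra.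
  rewrite -(ler_pM2r P3) mulNr -mulrA P2 => h4.
  by apply/andP; split; lra.
apply: (@le_trans _ _ (\sum_e W * \prod_i (clamp (s n.+1 k (child n a e) i + 2 ^+ k) - clamp (s n.+1 k (child n a e) i)))).
  by apply: ler_sum => e _; apply: IH; rewrite addSnnS.
have sE e i : s n.+1 k (child n a e) i = s n k.+1 a i + 2 ^+ k * (e i)%:R.
  have E : 2 ^- n.+1 * 2 ^+ (n + k.+1) = 2 ^+ k :> R.
    by rewrite -addSnnS exprD mulKf ?expf_neq0 ?pnatr_eq0.
  by rewrite /s !mxE addSnnS -E; ring.
rewrite -mulr_sumr ler_wpM2l //.
pose F i (b : bool) :=
  clamp (s n k.+1 a i + 2 ^+ k * b%:R + 2 ^+ k) - clamp (s n k.+1 a i + 2 ^+ k * b%:R).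
rewrite (eq_bigr (fun e : {ffun 'I_d -> bool} => \prod_i F i (e i))); last first.
  by move=> e _; apply: eq_bigr => i _; rewrite sE.
rewrite -bigA_distr_bigA le_eqVlt; apply/orP; left; apply/eqP.
apply: eq_bigr => i _; rewrite big_bool /F /= mulr1 mulr0 addr0.
rewrite (_ : 2 ^+ k.+1 = 2 ^+ k + 2 ^+ k); last by rewrite exprS mulr_natl mulr2n.
by rewrite [s n k.+1 a i + (_ + _)]addrA subrKA.
Qed.

Section Cover.
Hypothesis w_sub : forall n a, w n a <= \sum_e w n.+1 (child n a e).
Variables (X : nat -> set V) (N : nat -> nat).

(** Each covering set X i is traced by cubes of a single generation N i, to be
    chosen comparable to its size; deeper cubes no longer pay for it. *)
Definition level_cost n a i : R := if (n <= N i)%N then cost (X i) (N i - n) n a else 0.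

Lemma level_cost_ge0 n a i : 0 <= level_cost n a i.
Proof. by rewrite /level_cost; case: ifP => // _; exact: cost_ge0. Qed.

Lemma level_cost_children n a i :
  \sum_e level_cost n.+1 (child n a e) i <= level_cost n a i.
Proof.
rewrite /level_cost; have [nN|Nn] := ltnP n (N i).
  by rewrite (ltnW nN) -(subnSK nN).
by rewrite big1 //; case: ifP => // _; exact: cost_ge0.
Qed.

Definition total_cost n a : \bar R := (\sum_(0 <= i <oo) (level_cost n a i)%:E)%E.

Lemma total_cost_children n a :
  (\sum_e total_cost n.+1 (child n a e) <= total_cost n a)%E.
Proof.
rewrite /total_cost -nneseries_sum; last by move=> e i _; rewrite lee_fin level_cost_ge0.
apply: lee_nneseries => i *; first by apply: sume_ge0 => e _; rewrite lee_fin level_cost_ge0.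
by rewrite sumEFin lee_fin level_cost_children.
Qed.

(** If the cover were cheaper than the weight of the root, some child would be
    heavier than the part of the cover below it; following such children forever
    leads to a point that the cover misses. *)
Lemma surviving_path : (total_cost 0 0 < (w 0 0)%:E)%E ->
  exists a : nat -> V, [/\ dyadic_path a, forall n, 0 < w n (a n) &
    forall i, ~ (cube (N i) (a (N i)) `&` X i !=set0)].
Proof.
move=> root.
have step n a : {e | (total_cost n a < (w n a)%:E)%E ->
    (total_cost n.+1 (child n a e) < (w n.+1 (child n a e))%:E)%E}.
  apply: cid; case: (boolP (total_cost n a < (w n a)%:E)%E) => [h|_]; last by exists [ffun=> true].
  apply: contrapT => /forallNP no.
  suff : ((w n a)%:E <= total_cost n a)%E by rewrite leNgt h.
  apply: le_trans (total_cost_children n a).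
  apply: (@le_trans _ _ (\sum_e (w n.+1 (child n a e))%:E)%E).
    by rewrite sumEFin lee_fin.
  apply: lee_sum => e _.
  by have /not_implyP[_ /negP] := no e; rewrite -leNgt.
pose a := fix a n := if n is n'.+1 then child n' (a n') (projT1 (step n' (a n'))) else 0.
have cheap n : (total_cost n (a n) < (w n (a n))%:E)%E.
  by elim: n => [//|n IH] /=; exact: projT2 (step n (a n)) IH.
have tot0 n b : (0 <= total_cost n b)%E.
  by apply: nneseries_ge0 => i _ _; rewrite lee_fin level_cost_ge0.
exists a; split.
- by split=> // n; exists (projT1 (step n (a n))).
- by move=> n; rewrite -lte_fin; exact: le_lt_trans (cheap n).
- move=> i meets; have := cheap (N i); rewrite ltNge => /negP; apply.
  have -> : (w (N i) (a (N i)))%:E = (level_cost (N i) (a (N i)) i)%:E.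
    by rewrite /level_cost leqnn subnn /=; case: asboolP.
  rewrite /total_cost (@nneseriesD1 _ _ i) //=.
    rewrite leeDl // nneseries_ge0 // => j _ _; by rewrite lee_fin level_cost_ge0.
  by move=> j _; rewrite lee_fin level_cost_ge0.
Qed.

End Cover.
End Costs.
End DyadicTree.

(** * Bounded martingales survive on a set of full dimension *)

Section Potential.
Context {R : realType}.
Implicit Types (A L m t : R).

(** A discrete substitute for the first Dirichlet eigenfunction of [-L, L]: one
    step of the martingale decreases its mean at most by the factor 1 - A/L. *)
Definition potential L t : R := Num.max 0 (L ^+ 2 - t ^+ 2).

Lemma potential_ge0 L t : 0 <= potential L t.
Proof. by rewrite le_max lexx. Qed.

Lemma potential_le L t : potential L t <= L ^+ 2.
Proof. by rewrite ge_max sqr_ge0 lerBlDr lerDl sqr_ge0. Qed.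

(** A linear lower bound on the range of one step, up to the factor 1 - A/L. For
    m at distance at least A from the end points, the parabola falls at most A^2
    below its tangent, which is small against its height, at least A L. Nearer to
    an end point the height is too small for that, but there the line through the
    end point of slope 2L - 2A stays below the potential on both sides, and is
    steep enough. *)
Lemma potential_support A L m : 0 < A -> 2 * A <= L -> exists kappa, forall t,
  `|t - m| <= A -> (1 - A / L) * potential L m + kappa * (t - m) <= potential L t.
Proof.
move=> A0 AL; have L0 : 0 < L by lra.
have AL1 : 0 <= 1 - A / L by rewrite subr_ge0 ler_pdivrMr // mul1r; lra.
have lower t : L ^+ 2 - t ^+ 2 <= potential L t by rewrite le_max lexx orbT.
have end_case m' : L - A < m' -> m' < L -> forall t, `|t - m'| <= A ->
    (1 - A / L) * potential L m' - (2 * L - 2 * A) * (t - m') <= potential L t.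
  move=> mL mL' t; rewrite ler_norml => /andP[t1 t2].
  have c0 : 0 <= 2 * L - 2 * A by lra.
  have P0 := potential_ge0 L t.
  have -> : potential L m' = (L - m') * (L + m').
    by rewrite /potential max_r; [ring|nra].
  have H : (1 - A / L) * ((L - m') * (L + m')) <= (2 * L - 2 * A) * (L - m').
    have -> : (2 * L - 2 * A) * (L - m') = (1 - A / L) * ((L - m') * (2 * L)).
      by field; rewrite gt_eqF.
    by rewrite ler_wpM2l // ler_wpM2l; lra.
  apply: (@le_trans _ _ ((2 * L - 2 * A) * (L - t))); first by nra.
  have [tL|Lt] := leP L t.
    by apply: le_trans P0; rewrite mulr_ge0_le0 // subr_le0.
  by apply: le_trans (lower t); nra.
have [Lm|mL] := leP L `|m|.
  exists 0 => t _; rewrite mul0r addr0.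
  have -> : potential L m = 0.
    by apply/max_idPl; rewrite subr_le0 -[m ^+ 2]real_normK ?num_real // lerXn2r ?nnegrE // ltW.
  by rewrite mulr0 potential_ge0.
have [mid|far] := leP `|m| (L - A).
  exists (- (2 * m)) => t tm; apply: le_trans (lower t).
  have Em : potential L m = L ^+ 2 - m ^+ 2.
    rewrite /potential max_r // subr_ge0 -[m ^+ 2]real_normK ?num_real //.
    by rewrite lerXn2r ?nnegrE ?(ltW L0) // ltW.
  have H1 : (t - m) ^+ 2 <= A ^+ 2.
    by rewrite -[(t - m) ^+ 2]real_normK ?num_real // lerXn2r ?nnegrE ?(ltW A0).
  have H2 : L * A <= potential L m.
    rewrite Em -[m ^+ 2]real_normK ?num_real //.
    have : `|m| ^+ 2 <= (L - A) ^+ 2 by rewrite lerXn2r ?nnegrE //; lra.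
    nra.
  have H3 : A ^+ 2 <= A / L * potential L m.
    have -> : A ^+ 2 = A / L * (L * A) by field; rewrite gt_eqF.
    by rewrite ler_wpM2l // divr_ge0 ?(ltW A0) ?(ltW L0).
  rewrite mulrBl mul1r {1}Em.
  have -> : L ^+ 2 - t ^+ 2 = L ^+ 2 - m ^+ 2 - 2 * m * (t - m) - (t - m) ^+ 2 by ring.
  lra.
have sym t : potential L (- t) = potential L t by rewrite /potential sqrrN.
have [m0|m0] := leP 0 m.
  rewrite (ger0_norm m0) in mL far.
  exists (- (2 * L - 2 * A)) => t tm; rewrite mulNr; exact: end_case.
rewrite (ltr0_norm m0) in mL far.
exists (2 * L - 2 * A) => t tm.
have := end_case (- m) far mL (- t); rewrite !sym.
have -> : - t - - m = - (t - m) by ring.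
by rewrite normrN mulrN opprK => /(_ tm).
Qed.

End Potential.

Section LowerBound.
Context {R : realType} {d : nat}.
Local Notation V := 'rV[R]_d.
Implicit Types (x y a : V) (n : nat).

Variables (M : nat -> V -> R) (A : R).
Hypothesis A0 : 0 < A.
Hypothesis Mmean : forall n a, M n a = cmean (fun e => M n.+1 (child n a e)).
Hypothesis Minc : forall n a e, `|M n.+1 (child n a e) - M n a| <= A.

Lemma potential_mean L n a : 2 * A <= L ->
  (1 - A / L) * potential L (M n a) <= cmean (fun e => potential L (M n.+1 (child n a e))).
Proof.
move=> AL; have [kappa H] := potential_support (M n a) A0 AL.
have -> : (1 - A / L) * potential L (M n a) =
   cmean (fun e => (1 - A / L) * potential L (M n a) + kappa * (M n.+1 (child n a e) - M n a)).
  by rewrite cmeanD cmeanZ cmeanB !cmean_const -Mmean subrr mulr0 addr0.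
by apply: ler_cmean => e; exact: H.
Qed.

(** Weights are subadditive from a cube to its halves as long as the loss 1 - A/L
    is compensated by the excess of the 2^d halves over the factor 2^s. *)
Definition weight L s n a : R := potential L (M n a) * (2 ^- n) `^ s.

Lemma weight_ge0 L s n a : 0 <= weight L s n a.
Proof. by rewrite mulr_ge0 ?powR_ge0 ?potential_ge0. Qed.

Lemma weight_sub L s n a : 2 * A <= L -> 2 `^ s <= 2 ^+ d * (1 - A / L) ->
  weight L s n a <= \sum_e weight L s n.+1 (child n a e).
Proof.
move=> AL sL; rewrite /weight -mulr_suml.
have -> : \sum_e potential L (M n.+1 (child n a e)) =
    2 ^+ d * cmean (fun e => potential L (M n.+1 (child n a e))).
  by rewrite /cmean mulrA mulfV ?mul1r // expf_neq0 // pnatr_eq0.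
have -> : (2 ^- n : R) `^ s = 2 `^ s * (2 ^- n.+1) `^ s.
  by rewrite pow2VS powRM // ltW ?pow2V_gt0.
rewrite mulrA ler_wpM2r ?powR_ge0 //.
apply: (@le_trans _ _ (2 ^+ d * ((1 - A / L) * potential L (M n a)))).
  by rewrite [leRHS]mulrA [leLHS]mulrC ler_wpM2r ?potential_ge0.
by rewrite ler_wpM2l ?exprn_ge0 // potential_mean.
Qed.

Lemma dyadic_scale (t : R) : 0 < t -> t <= 1 -> exists n, t <= 2 ^- n <= 2 * t.
Proof.
move=> t0 t1.
have ex : exists n, (2 ^- n.+1 < t).
  exists (Num.trunc t^-1).+1.
  have /andP[_ h] := truncn_itv (x := t^-1) (ltac:(by rewrite invr_ge0 ltW)).
  rewrite -[ltRHS]invrK ltf_pV2 ?posrE ?exprn_gt0 ?invr_gt0 //.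
  apply: (lt_trans h); rewrite -natrX ltr_nat.
  exact: ltn_trans (ltnSn _) (ltn_expl _ _).
have [n nP nmin] := ex_minnP ex; exists n; apply/andP; split; last first.
  by rewrite pow2VS ler_wpM2l // ltW.
case: n nP nmin => [|n] nP nmin; first by rewrite expr0 invr1.
by rewrite leNgt; apply/negP => /nmin; rewrite ltnn.
Qed.

Lemma norm_sub_diam (X : set V) x y : X x -> X y -> (`|x - y|%:E <= diam X)%E.
Proof.
move=> Xx Xy; apply: (@le_trans _ _ (enorm (x - y))%:E); first by rewrite lee_fin norm_le_enorm.
by apply: ereal_sup_ubound; exists x => //; exists y.
Qed.

Lemma diam_pow_ge0 (s : R) (X : set V) : (0 <= diam_pow s X)%E.
Proof. by rewrite /diam_pow; case: ifP => // _; exact: poweR_ge0. Qed.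

(** The weights of the cubes with potential L play the role of a Frostman measure
    of exponent s' on the points whose path has |M| < L. Replacing each covering
    set by the at most 4^d cubes of comparable side that meet it, a cover of
    small total size would be cheaper than the weight of the root, and would miss
    such a point. *)
Lemma martingale_content (E : set V) (s : R) : 0 <= s -> s < d%:R ->
  (forall (a : nat -> V) (L : R), dyadic_path a -> (forall n, `|M n (a n)| <= L) ->
     forall x, (forall n, cube n (a n) x) -> E x) ->
  exists2 c : R, 0 < c & forall X : (set V)^nat, E `<=` \bigcup_i X i ->
    (forall i, (diam (X i) <= 1%:E)%E) ->
    (c%:E <= \sum_(0 <= i <oo) diam_pow s (X i))%E.
Proof.
move=> s0 sd HE.
pose s' : R := (s + d%:R) / 2.
have s's : s < s' by rewrite /s'; lra.
have s'd : s' < d%:R by rewrite /s'; lra.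
have s'0 : 0 < s' by exact: le_lt_trans s's.
pose theta : R := 2 `^ (s' - d%:R).
have th1 : theta < 1.
  rewrite -ltr_ln ?posrE ?powR_gt0 // ln_powR ln1 nmulr_rlt0 ?subr_lt0 //.
  by apply: ln_gt0; rewrite ltr1n.
(* L is large enough for 2^s' <= 2^d (1 - A/L) *)
pose q := A / (1 - theta); pose L := q + 2 * A + `|M 0%N 0| + 1.
have q0 : 0 < q by rewrite divr_gt0 // subr_gt0.
have m0 := normr_ge0 (M 0%N 0).
have [L0 AL qL mL] : [/\ 0 < L, 2 * A <= L, q <= L & `|M 0%N 0| < L].
  by have := A0; rewrite /L; clearbody q => ?; split; lra.
have sL : 2 `^ s' <= 2 ^+ d * (1 - A / L).
  have -> : 2 `^ s' = 2 ^+ d * theta.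
    by rewrite /theta powRB ?pnatr_eq0 ?implybT // powR_mulrn // mulrC divfK // expf_neq0 // pnatr_eq0.
  rewrite ler_wpM2l ?exprn_ge0 // lerBrDr addrC -lerBrDr ler_pdivrMr //.
  by rewrite mulrC -ler_pdivrMr ?subr_gt0.
pose w := weight L s'.
have w_sub n a : w n a <= \sum_e w n.+1 (child n a e) by exact: weight_sub.
pose w0 := w 0%N 0.
have w00 : 0 < w0.
  rewrite /w0 /w /weight expr0 invr1 powR1 mulr1 lt_max; apply/orP; right.
  rewrite subr_gt0 -[ltLHS]real_normK ?num_real // ltrXn2r ?nnegrE ?(ltW L0) //.
pose Q := 4 ^+ d * L ^+ 2 * 2 `^ s'.
have Q0 : 0 < Q by rewrite !mulr_gt0 ?exprn_gt0 ?powR_gt0.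
pose kap := Num.min 1 (w0 / (2 * Q)).
have kap0 : 0 < kap by rewrite lt_min ltr01 /= divr_gt0 // mulr_gt0.
have kap1 : kap <= 1 by rewrite ge_min lexx.
have kapw : Q * kap <= w0 / 2.
  have : kap <= w0 / (2 * Q) by rewrite ge_min lexx orbT.
  by rewrite invfM mulrA ler_pdivlMr // mulrC.
exists (w0 / (2 * Q)); first by rewrite divr_gt0 // mulr_gt0.
move=> X EX Xd; rewrite leNgt; apply/negP => cheap.
(* covering sets may be single points; they are given a positive size eta i, with
   summable powers *)
pose eta i := (kap / 2 ^+ i.+1) `^ s'^-1.
have kapi i : 0 < kap / 2 ^+ i.+1 <= 1.
  rewrite divr_gt0 ?exprn_gt0 //= ler_pdivrMr ?exprn_gt0 // mul1r.
  by rewrite (le_trans kap1) // exprn_ege1 // ler1n.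
have eta0 i : 0 < eta i by rewrite powR_gt0; case/andP: (kapi i).
have etas i : eta i `^ s' = kap / 2 ^+ i.+1.
  by rewrite /eta -powRrM mulVf ?gt_eqF // powRr1 // ltW; case/andP: (kapi i).
have eta1 i : eta i <= 1.
  rewrite -(powRr0 (kap / 2 ^+ i.+1)); apply: ger_powR; first exact: kapi.
  by rewrite invr_ge0 ltW.
have diamE i : X i !=set0 -> exists2 D : R, 0 <= D <= 1 & diam (X i) = D%:E.
  move=> [z Xz]; have := norm_sub_diam Xz Xz; rewrite subrr normr0.
  by have := Xd i; case: (diam (X i)) => [D| |] //; rewrite !lee_fin => D1 D0; exists D; rewrite ?D0.
have scale i : exists n, (X i !=set0 -> (diam (X i) <= (2 ^- n)%:E)%E) /\
   (X i !=set0 -> (((2 ^- n) `^ s')%:E <= (2 `^ s')%:E * (diam_pow s (X i) + (kap / 2 ^+ i.+1)%:E))%E).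
  have [Xi|Xi0] := pselect (X i !=set0); last by exists 0%N.
  have [D /andP[D0 D1] DE] := diamE i Xi.
  have t0 : 0 < Num.max D (eta i) by rewrite lt_max eta0 orbT.
  have t1 : Num.max D (eta i) <= 1 by rewrite ge_max D1 eta1.
  have [n /andP[n1 n2]] := dyadic_scale t0 t1.
  exists n; split=> [_|[z Xz]].
    by rewrite DE lee_fin (le_trans _ n1) // le_max lexx.
  rewrite /diam_pow; case: eqP => [X0|_]; first by rewrite X0 in Xz.
  rewrite DE poweR_EFin -EFinD -EFinM lee_fin.
  have DD : D `^ s' <= D `^ s.
    have [->|Dn0] := eqVneq D 0; first by rewrite powR0 ?powR_ge0 // gt_eqF.
    by apply: ger_powR; [rewrite lt_neqAle eq_sym Dn0 D0 D1|exact: ltW].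
  apply: (@le_trans _ _ ((2 * Num.max D (eta i)) `^ s')).
    apply: ge0_ler_powR; rewrite ?nnegrE ?(ltW s'0) ?(ltW (pow2V_gt0 _)) //.
    by rewrite mulr_ge0 // ltW.
  rewrite powRM ?(ltW t0) // ler_wpM2l ?powR_ge0 //.
  have := powR_ge0 D s; have := powR_ge0 (eta i) s'; rewrite -etas.
  by case: (leP D (eta i)) => _; lra.
have [N HN] : {N : nat -> nat & forall i,
   (X i !=set0 -> (diam (X i) <= (2 ^- N i)%:E)%E) /\
   (X i !=set0 -> (((2 ^- N i) `^ s')%:E <= (2 `^ s')%:E * (diam_pow s (X i) + (kap / 2 ^+ i.+1)%:E))%E)}.
  exact: (choice scale).
have w_ge0 n a : 0 <= w n a by exact: weight_ge0.
have root : (total_cost w X N 0 0 < (w 0%N 0)%:E)%E.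
  have ci i : ((level_cost w X N 0 0 i)%:E <= Q%:E * (diam_pow s (X i) + (kap / (2 ^ i.+1)%:R)%:E))%E.
    rewrite natrX /level_cost leq0n subn0.
    have [->|/set0P Xi] := eqVneq (X i) set0.
      rewrite cost_empty mule_ge0 ?lee_fin ?(ltW Q0) // adde_ge0 ?diam_pow_ge0 // lee_fin.
      by case/andP: (kapi i) => /ltW.
    have [h1 h2] := HN i; have := h2 Xi => h3.
    apply: (@le_trans _ _ (4 ^+ d * (L ^+ 2 * (2 ^- N i) `^ s'))%:E).
      rewrite lee_fin; apply: cost_bound => // [|b|x y Xx Xy].
      - by rewrite mulr_ge0 ?sqr_ge0 ?powR_ge0.
      - by rewrite add0n ler_wpM2r ?powR_ge0 ?potential_le.
      - by rewrite add0n -lee_fin; apply: le_trans (h1 Xi); exact: norm_sub_diam.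
    have -> : Q%:E = ((4 ^+ d * L ^+ 2)%:E * (2 `^ s')%:E)%E by rewrite -EFinM.
    rewrite mulrA EFinM -muleA; apply: lee_wpmul2l; last exact: h3.
    by rewrite lee_fin mulr_ge0 ?exprn_ge0 ?(ltW L0).
  apply: (@le_lt_trans _ _ (\sum_(0 <= i <oo) (Q%:E * (diam_pow s (X i) + (kap / (2 ^ i.+1)%:R)%:E)))%E).
    by apply: lee_nneseries => i *; [rewrite lee_fin level_cost_ge0|exact: ci].
  have nn i : (0 <= diam_pow s (X i) + (kap / (2 ^ i.+1)%:R)%:E)%E.
    by rewrite adde_ge0 ?diam_pow_ge0 // lee_fin divr_ge0 // ltW.
  rewrite nneseriesZl //.
  apply: (@le_lt_trans _ _ (Q%:E * (\sum_(0 <= i <oo) diam_pow s (X i) + kap%:E))%E).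
    rewrite lee_wpmul2l ?lee_fin ?(ltW Q0) //; apply: epsilon_trick; last exact: ltW.
    by move=> i; exact: diam_pow_ge0.
  move: cheap; have : (0 <= \sum_(0 <= i <oo) diam_pow s (X i))%E.
    by apply: nneseries_ge0 => i _ _; exact: diam_pow_ge0.
  case: (\sum_(0 <= i <oo) _)%E => [S| |] // _; rewrite lte_fin => cheap.
  rewrite -EFinD -EFinM lte_fin mulrDr -/w0.
  have : Q * S < w0 / 2.
    by move: cheap; rewrite invfM mulrA ltr_pdivlMr // mulrC.
  lra.
have [a [pa wa missed]] := surviving_path w_ge0 w_sub root.
have [x xa] := dyadic_path_cube pa.
have [i _ Xix] : (\bigcup_i X i) x.
  apply/EX/(HE a L pa) => // n.
  rewrite leNgt; apply/negP => Ln; have := wa n; rewrite /w /weight.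
  have -> : potential L (M n (a n)) = 0.
    apply/max_idPl; rewrite subr_le0 -[leRHS]real_normK ?num_real //.
    by rewrite lerXn2r ?nnegrE ?(ltW L0) // ltW.
  by rewrite mul0r ltxx.
by apply: (missed i); exists x.
Qed.

End LowerBound.

(** * Hausdorff dimension is at most the dimension of the space *)

Section UpperBound.
Context {R : realType} {d : nat}.
Local Notation V := 'rV[R]_d.
Implicit Types (x y : V) (X Y : set V) (s D delta eps : R).

Lemma diam_pow_le s D X : 0 <= s -> 0 <= D ->
  (forall x y, X x -> X y -> enorm (x - y) <= D) -> (diam_pow s X <= (D `^ s)%:E)%E.
Proof.
move=> s0 D0 XD; rewrite /diam_pow; case: eqP => [_|/eqP/set0P[z Xz]].
  by rewrite lee_fin powR_ge0.
have dD : (diam X <= D%:E)%E.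
  by apply: ge_ereal_sup => _ [x Xx [y Xy <-]]; rewrite lee_fin; exact: XD.
have := norm_sub_diam Xz Xz; rewrite subrr normr0.
case: (diam X) dD => [t| |] //; rewrite !lee_fin => tD t0.
by apply: ge0_ler_powR; rewrite ?nnegrE.
Qed.

Definition fine_cover delta s eps X (U : (set V)^nat) : Prop :=
  [/\ X `<=` \bigcup_i U i, forall i, (diam (U i) <= delta%:E)%E &
      (\sum_(0 <= i <oo) diam_pow s (U i) <= eps%:E)%E].

Lemma finite_fine_cover delta s D X (J : finType) (U : J -> set V) :
  0 <= s -> 0 <= D -> D <= delta ->
  (forall x, X x -> exists j, U j x) ->
  (forall j x y, U j x -> U j y -> enorm (x - y) <= D) ->
  exists W, fine_cover delta s (#|J|%:R * D `^ s) X W.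
Proof.
move=> s0 D0 Dd XU UD.
pose W i := if insub i is Some o then U (enum_val (o : 'I_#|J|)) else set0.
have WD i x y : W i x -> W i y -> enorm (x - y) <= D.
  by rewrite /W; case: insub => // o; exact: UD.
have Wle i : (diam_pow s (W i) <= (D `^ s)%:E)%E by apply: diam_pow_le => // x y; exact: WD.
exists W; split=> [x /XU[j Ujx]|i|].
- exists (enum_rank j) => //; rewrite /W; case: insubP => [u _ uE|]; last by rewrite ltn_ord.
  have -> : u = enum_rank j by exact: val_inj.
  by rewrite enum_rankK.
- apply: (@le_trans _ _ D%:E); last by rewrite lee_fin.
  by apply: ge_ereal_sup => _ [x Wx [y Wy <-]]; rewrite lee_fin; exact: WD Wx Wy.
rewrite (nneseries_split 0 #|J|) => [|k _]; last exact: diam_pow_ge0.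
rewrite [X in (_ + X)%E]eseries0 ?adde0; last first.
  move=> i; rewrite add0n => Ji _; rewrite /W insubF ?ltnNge ?Ji //.
  by rewrite /diam_pow eqxx.
apply: (le_trans (lee_sum _ (fun i _ => Wle i))).
by rewrite big_mkord sumEFin sumr_const card_ord lee_fin mulr_natl.
Qed.

(** Cutting the ball of the sup norm into n^d cubes costs a constant times n^(d-s). *)
Lemma box_fine_cover delta s eps r : 0 < delta -> d%:R < s -> 0 < eps -> 0 < r ->
  exists W, fine_cover delta s eps [set x | `|x| <= r] W.
Proof.
move=> delta0 ds eps0 r0.
have s0 : 0 < s by apply: le_lt_trans ds.
pose D := d%:R * (2 * r).
have D0 : 0 <= D by rewrite !mulr_ge0 // ltW.
have sd0 : 0 < s - d%:R by rewrite subr_gt0.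
have De : 0 <= D `^ s / eps by rewrite divr_ge0 ?powR_ge0 // ltW.
pose Z := (D `^ s / eps) `^ (s - d%:R)^-1 + D / delta.
have Z0 : 0 <= Z by rewrite addr_ge0 ?powR_ge0 // divr_ge0 // ltW.
pose n := Num.trunc Z.
have Zn : Z <= n.+1%:R by have /andP[_ /ltW] := truncn_itv Z0.
have N0 : 0 < n.+1%:R :> R by rewrite ltr0n.
have Dn : D / n.+1%:R <= delta.
  rewrite ler_pdivrMr // mulrC -ler_pdivrMr //; apply: le_trans Zn.
  by rewrite lerDr powR_ge0.
pose h := 2 * r / n.+1%:R.
have h0 : 0 < h by rewrite divr_gt0 // mulr_gt0.
pose U (k : {ffun 'I_d -> 'I_n.+1}) : set V :=
  [set x | forall i, - r + (k i)%:R * h <= x ord0 i <= - r + (k i)%:R * h + h].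
have [|||||W [W1 W2 W3]] := @finite_fine_cover delta s (D / n.+1%:R) [set x | `|x| <= r] _ U.
- exact: ltW.
- by rewrite divr_ge0.
- exact: Dn.
- move=> x /= xr.
  have [k kP] : {k : 'I_d -> 'I_n.+1 & forall i,
      - r + (k i)%:R * h <= x ord0 i <= - r + (k i)%:R * h + h}.
    apply: (@choice _ _ (fun i (k : 'I_n.+1) => - r + k%:R * h <= x ord0 i <= - r + k%:R * h + h)) => i.
    have := le_trans (ler_coord_norm x i) xr; rewrite ler_norml => /andP[x1 x2].
    have q0 : 0 <= (x ord0 i + r) / h by rewrite divr_ge0 ?(ltW h0) //; lra.
    have /andP[t1 t2] := truncn_itv q0; set t := Num.trunc _ in t1 t2.
    rewrite ler_pdivlMr // in t1; rewrite ltr_pdivrMr // -natr1 mulrDl mul1r in t2.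
    have nh : n.+1%:R * h = 2 * r by rewrite /h mulrC divfK // gt_eqF.
    have [tn|nt] := ltnP t n.+1.
      by exists (Ordinal tn) => /=; apply/andP; split; lra.
    exists ord_max => /=.
    have : n.+1%:R * h <= t%:R * h by rewrite ler_wpM2r ?(ltW h0) // ler_nat.
    by rewrite nh; move: nh; rewrite -natr1 mulrDl mul1r => nh nt'; apply/andP; split; lra.
  by exists [ffun i => k i] => i; rewrite ffunE.
- move=> k x y kx ky; apply: (le_trans (enorm_le_norm _)).
  rewrite /D -mulrA ler_wpM2l //; apply: norm_rV_le; first exact: ltW.
  move=> i; rewrite !mxE ler_norml; have /andP[? ?] := kx i; have /andP[? ?] := ky i.
  by rewrite -/h; apply/andP; split; lra.
exists W; split=> //; apply: (le_trans W3); rewrite lee_fin.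
rewrite card_ffun !card_ord natrX -powR_mulrn ?(ltW N0) // powRM ?invr_ge0 ?(ltW N0) // powR_inv ?(ltW N0) //.
have nd : n.+1%:R `^ s = n.+1%:R `^ d%:R * n.+1%:R `^ (s - d%:R) :> R.
  by rewrite -powRD ?(gt_eqF N0) ?implybT // addrC subrK.
have Zs : D `^ s / eps <= n.+1%:R `^ (s - d%:R).
  have {1}-> : D `^ s / eps = ((D `^ s / eps) `^ (s - d%:R)^-1) `^ (s - d%:R).
    by rewrite -powRrM mulVf ?gt_eqF // powRr1.
  apply: ge0_ler_powR; rewrite ?nnegrE ?powR_ge0 ?(ltW sd0) ?(ltW N0) //.
  by apply: le_trans Zn; rewrite lerDl divr_ge0 // ltW.
have P0 : 0 < n.+1%:R `^ d%:R :> R by rewrite powR_gt0.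
have P1 : 0 < n.+1%:R `^ (s - d%:R) :> R by rewrite powR_gt0.
rewrite nd [leLHS](_ : _ = D `^ s / n.+1%:R `^ (s - d%:R)); last by field; rewrite !gt_eqF.
by rewrite ler_pdivrMr // mulrC -ler_pdivrMr.
Qed.

(** The costs eps / 2^(j+1) add up to eps over a double sequence of covering sets. *)
Lemma countable_fine_cover delta s eps (X : nat -> set V) : 0 <= eps ->
  (forall j, exists W, fine_cover delta s (eps / (2 ^ j.+1)%:R) (X j) W) ->
  exists W, fine_cover delta s eps (\bigcup_j X j) W.
Proof.
move=> eps0 /choice[G GX].
have /card_esym/card_set_bijP[g gbij] := card_nat2.
pose a (k : nat * nat) := diam_pow s (G k.1 k.2).
have a0 k : (0 <= a k)%E by exact: diam_pow_ge0.
exists (fun i => G (g i).1 (g i).2); split=> [x [j _ Xjx]|i|].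
- have [XG _ _] := GX j; have [k _ Gx] := XG x Xjx.
  have [_ _ gsurj] := gbij; have [i _ gi] := gsurj (j, k) I.
  by exists i => //; rewrite gi.
- by case: (GX (g i).1) => _ h _; exact: h.
rewrite nneseries_esumT => [|i]; last exact: diam_pow_ge0.
rewrite -(reindex_esum setT setT g a gbij).
have -> : \esum_(k in setT) a k = \esum_(i in setT) \esum_(j in setT) a (i, j).
  rewrite (@esum_esum _ _ _ setT (fun=> setT) (fun i j => a (i, j))) //.
  have -> : setT `*`` (fun=> setT) = setT :> set (nat * nat) by apply/seteqP; split.
  by apply: eq_esum => -[].
rewrite -nneseries_esumT => [|i]; last by apply: esum_ge0.
apply: le_trans (epsilon_trick0 xpredT eps0).
apply: lee_nneseries => j *; first exact: esum_ge0.
by rewrite -nneseries_esumT //; case: (GX j).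
Qed.

Lemma hausdorff_measure_eq0 s (E : set V) : d%:R < s -> hausdorff_measure s E = 0%E.
Proof.
move=> ds; have content_ge0 delta : (0 <= hausdorff_content delta s E)%E.
  apply: le_ereal_inf_tmp => _ [W _ <-]; apply: nneseries_ge0 => i _ _.
  exact: diam_pow_ge0.
apply/eqP; rewrite eq_le; apply/andP; split; last first.
  apply: le_trans (content_ge0 1) _; apply: ereal_sup_ubound.
  by exists 1 => //=; exact: ltr01.
apply: ge_ereal_sup => _ [delta /= delta0 <-].
apply/lee_addgt0Pr => eps eps0; rewrite add0e.
have [|j|W [W1 W2 W3]] := @countable_fine_cover delta s eps (fun j => [set x | `|x| <= j.+1%:R]).
- exact: ltW.
- apply: box_fine_cover => //.
  by rewrite divr_gt0 // ltr0n expn_gt0.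
apply: le_trans W3; apply: ereal_inf_lbound; exists W => //; split=> // x _.
apply: W1; exists (Num.trunc `|x|) => //=.
by have /andP[_ /ltW] := truncn_itv (normr_ge0 x).
Qed.

Lemma hausdorff_dim_le (E : set V) : (hausdorff_dim E <= d%:R%:E)%E.
Proof.
apply/lee_addgt0Pr => eps eps0; rewrite -EFinD.
apply: ereal_inf_lbound; exists (d%:R + eps) => //; split.
  by rewrite addr_ge0 // ltW.
by apply: hausdorff_measure_eq0; rewrite ltrDl.
Qed.

Lemma hausdorff_dim_ge (E : set V) :
  (forall s, 0 <= s -> s < d%:R -> exists2 c : R, 0 < c &
     forall X : (set V)^nat, E `<=` \bigcup_i X i -> (forall i, (diam (X i) <= 1%:E)%E) ->
     (c%:E <= \sum_(0 <= i <oo) diam_pow s (X i))%E) ->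
  (d%:R%:E <= hausdorff_dim E)%E.
Proof.
move=> HE; apply: le_ereal_inf_tmp => _ [s [s0 ms] <-].
rewrite lee_fin leNgt; apply/negP => sd; have [c c0 Hc] := HE s s0 sd.
have : (c%:E <= hausdorff_measure s E)%E.
  apply: (@le_trans _ _ (hausdorff_content 1 s E)).
    by apply: le_ereal_inf_tmp => _ [X [EX Xd] <-]; exact: Hc.
  by apply: ereal_sup_ubound; exists 1 => //=; exact: ltr01.
by rewrite ms lee_fin leNgt c0.
Qed.

End UpperBound.

(** * Boundedness of the truncated integrals *)

(** A point of a path along which |M| is at most L has |U eps| at most L + 3 K,
    since every eps is comparable to a dyadic scale. *)
Lemma bounded_truncations_dim (R : realType) (d : nat) (U : R -> 'rV[R]_d -> R) (K : R) :
  0 <= K -> approximate_martingale U K ->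
  hausdorff_dim [set x : 'rV[R]_d | (ereal_sup [set `|U eps x|%:E |
     eps in [set eps : R | (0 < eps < 1)%R]] < +oo)%E] = (d%:R)%:E.
Proof.
move=> K0 UK; apply/eqP; rewrite eq_le hausdorff_dim_le /=.
have [M [Mmean MU]] := limit_martingale UK.
have A0 : 0 < 4 * K + 1 by lra.
have Minc n a e : `|M n.+1 (child n a e) - M n a| <= 4 * K + 1.
  by apply: le_trans (martingale_increment UK MU n a e) _; lra.
apply: hausdorff_dim_ge => s s0 sd.
apply: (martingale_content A0 Mmean Minc s0 sd) => a L pa aL x xa /=.
apply: (@le_lt_trans _ _ (L + 3 * K)%:E); last exact: ltry.
apply: ge_ereal_sup => _ [eps /= /andP[e0 e1] <-]; rewrite lee_fin.
have [n /andP[n1 n2]] := dyadic_scale e0 (ltW e1).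
have xn : `|x - a n| <= 2 ^- n.
  apply: norm_rV_le => [|i]; first by rewrite ltW ?pow2V_gt0.
  have P := pow2V_gt0 (R := R) n.
  by have /andP[x1 x2] := xa n i; rewrite !mxE ger0_norm; lra.
have := martingale_controls UK MU (eps := eps) xn; rewrite n1 andbT.
have -> : 2 ^- n.+1 <= eps by move: n2; rewrite pow2VS; lra.
move=> /(_ isT); have := aL n.
by rewrite !ler_norml => /andP[? ?] /andP[? ?]; apply/andP; split; lra.
Qed.

(** The integer part of m + alpha is m, or m + 1 when alpha = 1. *)
Lemma kills_moments (R : realType) (d m : nat) (alpha : R)
  (I : ('rV[R]_d -> R) -> R) : 0 < alpha ->
  (forall k : 'I_d -> nat,
     (\sum_(i < d) k i)%N%:Z <= Num.floor (m%:R + alpha) -> I (monomial k) = 0) ->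
  kills (m + (alpha == 1)) I.
Proof.
move=> alpha0 HI k km; apply: HI; rewrite floor_ge_int_tmp -pmulrn.
have : (\sum_(i < d) k i)%N%:R <= (m + (alpha == 1)%R)%N%:R :> R by rewrite ler_nat.
by rewrite natrD; case: eqP => [->|_] /=; rewrite ?mulr1n ?mulr0n; lra.
Qed.

Theorem corollary1p4 (R : realType) (d : nat) (hd : (0 < d)%N)
  (m : nat) (alpha : R) (halpha0 : 0 < alpha) (halpha1 : alpha <= 1)
  (f : 'rV[R]_d -> R) (hf : C_class m alpha f)
  (sigma : {charge set (borelRd R d) -> \bar R})
  (hsupp : compactly_supported sigma)
  (hmoments : forall k : 'I_d -> nat,
     (\sum_(i < d) k i)%N%:Z <= Num.floor (m%:R + alpha) ->
     charge_Rintegral sigma (monomial k) = 0) :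
  hausdorff_dim
    [set x : 'rV[R]_d |
      (ereal_sup [set `|Theta sigma (m%:R + alpha) eps f x|%:E |
         eps in [set eps : R | (0 < eps < 1)%R]] < +oo)%E] = (d%:R)%:E.
Proof.
have [rho [B bI]] := charge_bounded_functional hsupp.
have kI := kills_moments halpha0 hmoments.
have [Es Et Ea] := estimates halpha0 halpha1 bI kI hf.
have cf := C_class_continuous halpha0 hf.
have [K K0 UK] := trunc_integral_approximate_martingale bI cf
  (avg_rate_gt0 halpha1) (shift_rate_gt0 halpha0) Es Et Ea.
exact: bounded_truncations_dim K0 UK.
Qed.
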